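(* Let $N\ge 1$ and let $\mathcal A$ be a Markov generator acting on functions on $\mathbb R^N$ such that, for every $0\le\varphi\in L^1(\mathbb R^N)$, the solution $v$ of $$\partial_t v(x,t)=\mathcal A\,v(x,t)\ \text{ in }\mathbb R^N\times(0,\infty),\qquad v(x,0)=\varphi(x)\ \text{ in }\mathbb R^N,$$ is non-negative and satisfies $v(x,\cdot)\in L^1(0,\infty)$ for $x\in\mathbb R^N$. Let $\mathbf k$ be a non-negative kernel in $L^1_{loc}(\mathbb R_+)$ associated with a subordinator, with Laplace transform $\mathcal K(\lambda)$ and inverse-subordinator density $G_t(\tau)$ (see context). Assume that $\lambda\mathcal K(\lambda)\to 0$ as $\lambda\to0^+$ and that, for some $\varrho\ge 0$, the function $L(x):=x^{-\varrho}\,\mathcal K(x^{-1})$ is slowly varying at infinity. Then for every $0\le\varphi\in L^1(\mathbb R^N)$ and every $x\in\mathbb R^N$, the subordinated solution $v^E(x,t)=\int_0^\infty v(x,\tau)\,G_t(\tau)\,d\tau$ satisfies $$\frac1t\int_0^t v^E(x,s)\,ds\ \sim\ \frac{\|v(x)\|_1}{\Gamma(\varrho+1)}\; t^{-1}\,\mathcal K(t^{-1})\qquad\text{as }t\to\infty,$$ where $\|v(x)\|_1=\int_0^\infty v(x,\tau)\,d\tau$; that is, $$\lim_{t\to\infty}\frac{\frac1t\int_0^t v^E(x,s)\,ds}{t^{-1}\mathcal K(t^{-1})}=\frac{\|v(x)\|_1}{\Gamma(\varrho+1)} .$$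
   Context: Subordinator and kernel: $\mathbf S=\{\mathbf S_t\}_{t\ge0}$ is a subordinator (a process with stationary independent non-negative increments, starting at $0$) with $\mathbb E(e^{-\lambda \mathbf S_t})=e^{-t\Phi(\lambda)}$, where $\Phi(\lambda)=\int_{(0,\infty)}(1-e^{-\lambda\tau})\,\sigma(d\tau)$ and $\sigma$ is a measure on $(0,\infty)$ with $\int_{(0,\infty)}(1\wedge\tau)\,\sigma(d\tau)<\infty$. The associated kernel is $\mathbf k(t)=\sigma((t,\infty))$; its Laplace transform is $\mathcal K(\lambda)=\int_0^\infty e^{-\lambda t}\mathbf k(t)\,dt=\Phi(\lambda)/\lambda$, $\lambda>0$. Inverse subordinator: $E_t=\inf\{s\ge0:\mathbf S_s\ge t\}$, and $G_t(\tau)$, $\tau>0$, is the density of the law of $E_t$. It is a known fact that $\int_0^\infty e^{-\lambda t}G_t(\tau)\,dt=\mathcal K(\lambda)e^{-\tau\lambda\mathcal K(\lambda)}$ for $\lambda,\tau>0$. A (positive, measurable) function $L$ is slowly varying at infinity if $\lim_{x\to\infty}L(\lambda x)/L(x)=1$ for every $\lambda>0$. The solution $v$ is understood as a jointly measurable function of $(x,t)$. $\Gamma$ is the Gamma function. *)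

(* Defs.v *)
From HB Require Import structures.
From mathcomp Require Import all_boot all_order all_algebra.
From mathcomp Require Import all_classical all_reals all_analysis.
Set Implicit Arguments.
Unset Strict Implicit.
Unset Printing Implicit Defensive.
Import Order.TTheory GRing.Theory Num.Theory.
Import numFieldNormedType.Exports.
Local Open Scope classical_set_scope.
Local Open Scope ring_scope.

(* Lebesgue measure on R^n, represented by [n.-tuple R] with its product
   sigma-algebra: the image of the product of the one-dimensional Lebesgue
   measure and of Lebesgue measure on R^(n-1) under (x, y) |-> x :: y. *)
Section lebesgue_tuple.
Context {R : realType}.

Definition tcons n (z : measurableTypeR R * n.-tuple R) : n.+1.-tuple R :=
  [tuple of (z.1 : R) :: z.2].

Lemma measurable_tcons n : measurable_fun setT (@tcons n).
Proof.
apply: (@measurable_cons _ _ _ _ (fun z : measurableTypeR R * _ => z.1 : R)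
  n snd); last exact: measurable_snd.
exact: (@measurable_fst _ _ (measurableTypeR R) (n.-tuple R)).
Qed.

Section step.
Variables (n : nat) (m : {sigma_finite_measure set (n.-tuple R) -> \bar R}).

Definition lebesgue_tupleS : set (n.+1.-tuple R) -> \bar R :=
  pushforward (@lebesgue_measure R \x m)%E (@tcons n).

Let lebesgue_tupleS0 : lebesgue_tupleS set0 = 0%E.
Proof. by rewrite /lebesgue_tupleS /pushforward preimage_set0 measure0. Qed.

Let lebesgue_tupleS_ge0 A : (0 <= lebesgue_tupleS A)%E.
Proof. exact: (measure_ge0 (@lebesgue_measure R \x m)%E). Qed.

Let lebesgue_tupleS_sigma_additive : semi_sigma_additive lebesgue_tupleS.
Proof.
move=> F mF tF mUF; rewrite /lebesgue_tupleS /pushforward preimage_bigcup.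
apply: measure_semi_sigma_additive.
- by move=> i; rewrite -[X in measurable X]setTI; exact: measurable_tcons.
- apply/trivIsetP => /= i j _ _ ij; rewrite -preimage_setI.
  by move/trivIsetP : tF => /(_ _ _ _ _ ij) ->//; rewrite preimage_set0.
- by rewrite -preimage_bigcup -[X in measurable X]setTI; exact: measurable_tcons.
Qed.

HB.instance Definition _ := isMeasure.Build _ _ _ lebesgue_tupleS
  lebesgue_tupleS0 lebesgue_tupleS_ge0 lebesgue_tupleS_sigma_additive.

Lemma lebesgue_tupleS_sigma_finite : sigma_finite setT lebesgue_tupleS.
Proof.
have /sigma_finiteP[F [TF ndF Foo]] := sigma_finiteT (@lebesgue_measure R).
have /sigma_finiteP[G [TG ndG Goo]] := sigma_finiteT m.
pose g (t : n.+1.-tuple R) : measurableTypeR R * n.-tuple R :=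
  (thead t, [tuple of behead t]).
have mg : measurable_fun setT g.
  apply/measurable_fun_pair => /=.
    exact: (@measurable_tnth _ R n.+1 ord0).
  exact: measurable_behead.
have gK : cancel (@tcons n) g.
  by move=> [x y]; rewrite /g /tcons/= theadE; congr pair; exact/val_inj.
exists (fun i => g @^-1` (F i `*` G i)).
  rewrite -preimage_bigcup -[LHS](preimage_setT g); congr (_ @^-1` _).
  rewrite -setXTT TF TG predeqE => -[x y]; split.
    move=> [/= [i _ Fix] [k _ Gky]]; exists (maxn i k) => //; split.
    - by move: x Fix; exact/subsetPset/ndF/leq_maxl.
    - by move: y Gky; exact/subsetPset/ndG/leq_maxr.
  by move=> [i _ []/= ? ?]; split; exists i.
move=> i; have [? ?] := Foo i; have [? ?] := Goo i; split.
  by rewrite -[X in measurable X]setTI; apply: mg => //; exact: measurableX.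
rewrite /lebesgue_tupleS /pushforward -comp_preimage.
rewrite (_ : g \o _ = id) ?preimage_id; last exact/funext.
by rewrite product_measure1E// lte_mul_pinfty// ge0_fin_numE.
Qed.

HB.instance Definition _ := @Measure_isSigmaFinite.Build _ _ _
  lebesgue_tupleS lebesgue_tupleS_sigma_finite.

End step.

Fixpoint lebesgue_tuple n : {sigma_finite_measure set (n.-tuple R) -> \bar R} :=
  if n is n'.+1 then @lebesgue_tupleS n' (lebesgue_tuple n')
  else \d_([tuple] : 0.-tuple R).

End lebesgue_tuple.

Lemma lebesgue_tuple_box {R : realType} n (A : 'I_n -> set R) :
  (forall i, measurable (A i)) ->
  lebesgue_tuple n [set t | forall i, A i (tnth t i)] =
  (\prod_(i < n) (@lebesgue_measure R) (A i))%E.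
Proof.
elim: n A => [A _|n IH A mA] /=.
  rewrite big_ord0 diracE mem_set//.
  by case.
rewrite /lebesgue_tupleS /pushforward big_ord_recl.
rewrite -(IH (fun i => A (lift ord0 i)))//.
rewrite -product_measure1E; last 2 first.
- exact: mA.
- rewrite (_ : mkset _ = \bigcap_(i in [set: 'I_n])
      ((fun t : n.-tuple R => tnth t i) @^-1` A (lift ord0 i))); last first.
    by apply/seteqP; split => t /= h i; [move=> _|]; exact: h.
  apply: fin_bigcap_measurable => // i _.
  by rewrite -[X in measurable X]setTI; exact: measurable_tnth.
congr ((_ \x _)%E _); apply/seteqP; split => [[x y] /= h|[x y] /= [hx hy] i].
  split; first exact: (h ord0).
  by move=> i; have := h (lift ord0 i); rewrite tnthS.
case: (unliftP ord0 i) => [j ->|->]; last exact: hx.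
by have := hy j; rewrite -(tnthS x y j).
Qed.

(* Functions on R^N; an operator acting on functions, with its domain, is given
   by its graph: [A (f, g)] means that f is in the domain of A and A f = g. *)
Definition function (R : realType) (N : nat) := N.-tuple R -> R.
Definition operator (R : realType) (N : nat) :=
  set (function R N * function R N).

Section markov.
Context {R : realType} {N : nat}.

(* Only the times t >= 0 of the family p are meaningful. *)
Definition markov_semigroup (p : R -> R.-pker (N.-tuple R) ~> (N.-tuple R)) :=
  (forall x U, measurable U -> p 0 x U = \d_x U) /\
  (forall (s t : R) x U, 0 <= s -> 0 <= t -> measurable U ->
     p (s + t) x U = (\int[p s x]_y p t y U)%E).

(* A f = lim_(h -> 0+) (P_h f - f) / h with P_h f x = \int f(y) p_h(x, dy), on
   all the functions for which every P_h f is defined and this limit exists at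
   every point; its restrictions include the generators in the sense of the
   uniform norm. *)
Definition generator (p : R -> R.-pker (N.-tuple R) ~> (N.-tuple R)) :
    operator R N :=
  [set fg | [/\ measurable_fun setT fg.1,
    forall (h : R) x, 0 <= h -> (p h x).-integrable setT (EFin \o fg.1) &
    forall x, h^-1 * ((\int[p h x]_y fg.1 y) - fg.1 x) @[h --> 0^'+] -->
      fg.2 x]].

Definition markov_generator (A : operator R N) :=
  exists2 p, markov_semigroup p & A = generator p.

(* v solves d/dt v = A v on R^N x (0, +oo), v(., 0) = phi. As phi is only an
   integrable function, v(x, .) is continuous at 0 for almost every x. *)
Definition cauchy_solution (A : operator R N) (phi : function R N)
    (v : N.-tuple R -> R -> R) :=
  [/\ measurable_fun [set z : N.-tuple R * R | 0 <= z.2]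
        (fun z : N.-tuple R * R => v z.1 z.2),
    forall t : R, 0 < t -> exists2 g, A (v ^~ t, g) &
      forall x, is_derive t 1 (v x) (g x),
    forall x, v x 0 = phi x &
    {ae (lebesgue_tuple N), forall x, v x t @[t --> 0^'+] --> phi x}].

End markov.

Section subordinator.
Context {R : realType}.
Local Notation leb := (@lebesgue_measure R).

(* A measure sigma on (0, +oo) is given by a Borel measure on R of which only
   the restriction to (0, +oo) is used. *)
Definition levy_measure (sigma : {measure set R -> \bar R}) :=
  (\int[sigma]_(tau in `]0%R, +oo[) (Num.min 1 tau)%:E < +oo)%E.

Definition laplace_exponent (sigma : {measure set R -> \bar R}) (l : R) : R :=
  \int[sigma]_(tau in `]0%R, +oo[) (1 - expR (- (l * tau))).

Definition subordinator d (Omega : measurableType d) (P : probability Omega R)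
    (S : R -> {RV P >-> R}) (sigma : {measure set R -> \bar R}) :=
  [/\ levy_measure sigma,
    forall w, S 0 w = 0,
    forall (s t : R) w, 0 <= s -> s <= t -> S s w <= S t w &
  [/\ forall (t h : R) B, 0 <= t -> 0 <= h -> measurable B ->
        P [set w | B (S (t + h) w - S t w)] = P [set w | B (S h w)],
      forall n (t : nat -> R) (B : nat -> set R), 0 <= t 0%N ->
        (forall i, t i <= t i.+1) -> (forall i, measurable (B i)) ->
        P [set w | forall i, (i < n)%N -> B i (S (t i.+1) w - S (t i) w)] =
        (\prod_(i < n) P [set w | B i (S (t i.+1) w - S (t i) w)%R])%E &
      forall t l : R, 0 <= t -> 0 <= l ->
        ('E_P[fun w => expR (- (l * S t w))])%E =
        (expR (- (t * laplace_exponent sigma l)))%:E]].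

(* E_t may take the value +oo = inf set0. *)
Definition inverse_subordinator (Omega : Type) (S : R -> Omega -> R) (t : R)
    (w : Omega) : \bar R :=
  ereal_inf [set s%:E | s in [set s | 0 <= s /\ t <= S s w]].

(* G t is a density on (0, +oo) of the law of E_t, for every t > 0 (E_0 = 0). *)
Definition inverse_density d (Omega : measurableType d) (P : probability Omega R)
    (S : R -> {RV P >-> R}) (G : R -> R -> R) :=
  forall t : R, 0 < t ->
  [/\ measurable_fun (`]0, +oo[ : set R) (G t),
    forall tau : R, 0 < tau -> 0 <= G t tau &
    forall B : set R, measurable B ->
      P (inverse_subordinator S t @^-1` (EFin @` B)) =
      (\int[leb]_(tau in `]0%R, +oo[ `&` B) (G t tau)%:E)%E].

(* Locally integrable on [0, +oo), i.e. up to and including 0. *)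
Definition loc_integrable (k : R -> R) :=
  forall T : R, 0 < T -> leb.-integrable `]0, T] (EFin \o k).

Definition associated_kernel (sigma : {measure set R -> \bar R}) (k : R -> R) :=
  forall t : R, 0 < t -> (k t)%:E = sigma `]t, +oo[%classic.

Definition laplace_transform (k : R -> R) (l : R) : R :=
  \int[leb]_(t in `]0%R, +oo[) (expR (- (l * t)) * k t).

Definition slowly_varying (L : R -> R) :=
  [/\ measurable_fun (`]0, +oo[ : set R) L, forall x : R, 0 < x -> 0 < L x &
    forall c : R, 0 < c -> L (c * x) / L x @[x --> +oo] --> (1 : R)].

Definition Gamma (s : R) : R :=
  \int[leb]_(x in `]0%R, +oo[) (x `^ (s - 1) * expR (- x)).

Definition subordinated {X : Type} (v : X -> R -> R) (G : R -> R -> R) (x : X)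
    (t : R) : \bar R :=
  (\int[leb]_(tau in `]0%R, +oo[) (v x tau * G t tau)%:E)%E.

End subordinator.

(* Main.v *)
Require Import Defs.
From HB Require Import structures.
From mathcomp Require Import all_boot all_order all_algebra.
From mathcomp Require Import all_classical all_reals all_analysis.
From mathcomp Require Import measurable_realfun ring lra.
Set Implicit Arguments.
Unset Strict Implicit.
Unset Printing Implicit Defensive.
Import Order.TTheory GRing.Theory Num.Theory.
Import numFieldNormedType.Exports.
Local Open Scope classical_set_scope.
Local Open Scope ring_scope.

(* Write [K] for the Laplace transform of [k], so that the Laplace exponent is
   [l * K l]. The value of the inverse subordinator at an independent
   exponential time of rate [l] is exponential of rate [l * K l], because it
   exceeds [a], up to a null event, iff [S a] is smaller than that time. Hence the
   Laplace transform of [s |-> v^E(x, s)] at [l] is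
   [K l * \int v(x, y) exp(- l K(l) y) dy], which is equivalent to
   [K l * ||v(x)||_1] as [l] tends to [0], by dominated convergence.
   As [K] varies regularly with index [- rho], Karamata's Tauberian theorem
   applies to the primitive [U] of [v^E(x, .)]. Working with the Laplace
   transform of the monotone function [U], rather than with that of its
   derivative, makes the limiting density [y ^ rho * exp(- y)] regular for all
   [rho >= 0], so that [rho = 0] is not a special case. *)

(** * Polynomial approximation *)

(** A Laplace transform only gives weighted means of [U], so [U t] must be recovered from means
    concentrated near [t]. Under [u = exp(- s / t)] the weight [exp(- s / t) * U s] becomes a
    measure on [0, 1] whose [n]-th moment is the Laplace transform of [U] at [(n + 1) / t]. After
    division by [t * K(1 / t)], regular variation makes every moment converge. Polynomial
    approximation extends the convergence to Lipschitz test functions, and these suffice: a narrow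
    tent on one side of [s = t], together with the monotonicity of [U], bounds [U t] from that side.
    The Laplace identities for [v^E], for [k] and for [U] share one device. Integrating a function
    against the exponential law of rate [l] gives [l] times its Laplace transform, so each identity
    is Tonelli's theorem for a product of that law with another measure, applied to non-negative
    functions with values in the extended reals. Finiteness can then be read off afterwards. *)

Section bernstein.
Context {R : archiRealFieldType}.
Implicit Types (g : nat -> R) (x : R).

(* [(bernstein n g).[x]] is the expectation of [g] under the binomial law with
   parameters [n] and [x], conditioning on the first of the [n] trials. *)
Fixpoint bernstein n g : {poly R} :=
  if n is n'.+1 then 'X * bernstein n' (g \o S) + (1 - 'X) * bernstein n' g
  else (g 0%N)%:P.

Lemma bernstein0E g x : (bernstein 0 g).[x] = g 0%N.
Proof. by rewrite hornerC. Qed.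

Lemma bernsteinSE n g x : (bernstein n.+1 g).[x] =
  x * (bernstein n (g \o S)).[x] + (1 - x) * (bernstein n g).[x].
Proof. by rewrite /= !hornerE. Qed.

Lemma bernstein_cst n c x : (bernstein n (fun=> c)).[x] = c.
Proof.
elim: n => [|n IH]; first exact: bernstein0E.
by rewrite bernsteinSE (_ : _ \o S = fun=> c)// IH; ring.
Qed.

Lemma bernsteinD n g1 g2 x :
  (bernstein n (g1 \+ g2)).[x] = (bernstein n g1).[x] + (bernstein n g2).[x].
Proof.
elim: n g1 g2 => [|n IH] g1 g2; first by rewrite !bernstein0E.
rewrite !bernsteinSE (_ : (_ \+ _) \o S = (g1 \o S) \+ (g2 \o S))// !IH; ring.
Qed.

Lemma bernsteinZ n c g x :
  (bernstein n (fun i => c * g i)).[x] = c * (bernstein n g).[x].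
Proof.
elim: n g => [|n IH] g; first by rewrite !bernstein0E.
rewrite !bernsteinSE (_ : (fun i => _) \o S = fun i => c * (g \o S) i)// !IH.
ring.
Qed.

Lemma le_bernstein n g1 g2 x : 0 <= x <= 1 -> (forall i, g1 i <= g2 i) ->
  (bernstein n g1).[x] <= (bernstein n g2).[x].
Proof.
move=> /andP[x0 x1]; elim: n g1 g2 => [|n IH] g1 g2 g12.
  by rewrite !bernstein0E.
rewrite !bernsteinSE lerD// ler_wpM2l ?subr_ge0// IH// => i; exact: g12.
Qed.

(** Squared bias plus variance of the binomial law. Leaving the centre [a] free makes the induction
    go through: a success in the first trial replaces [a] by [a - 1]. *)
Lemma bernstein_variance n a x : (bernstein n (fun i => (i%:R - a) ^+ 2)).[x] =
  (n%:R * x - a) ^+ 2 + n%:R * x * (1 - x).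
Proof.
elim: n a => [|n IH] a; first by rewrite bernstein0E; ring.
rewrite bernsteinSE (_ : _ \o S = fun i => (i%:R - (a - 1)) ^+ 2); last first.
  by apply/funext => i /=; rewrite -(natr1 i); ring.
rewrite !IH -(natr1 n); ring.
Qed.

Lemma lipschitz_polynomial_approx (h : R -> R) (M e : R) : 0 < e ->
  (forall x y, `|h x - h y| <= M * `|x - y|) ->
  exists p : {poly R}, forall x, 0 <= x <= 1 -> `|h x - p.[x]| <= e.
Proof.
move=> e0 hM.
(* AM-GM: [M |d| <= e / 2 + M ^+ 2 / (2 e) * d ^+ 2] *)
have hC x y : `|h x - h y| <= e / 2 + M ^+ 2 / (2 * e) * (y - x) ^+ 2.
  apply: (le_trans (hM x y)); rewrite -(real_normK (num_real (y - x))) distrC.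
  set d := `|_|; rewrite -subr_ge0.
  rewrite (_ : _ - _ = (e - M * d) ^+ 2 / (2 * e)); last first.
    by field; rewrite gt_eqF.
  by rewrite divr_ge0 ?sqr_ge0 ?mulr_ge0 ?ltW.
(* The quadratic term has mean [M ^+ 2 / (2 * e) * x * (1 - x) / n.+1], and [x * (1 - x) <= 1], so
   this size of [n] brings it below [e / 2]. *)
have [n nM] : exists n : nat, M ^+ 2 / e ^+ 2 <= n%:R.
  exists (Num.Def.archi_bound (M ^+ 2 / e ^+ 2)).
  by apply/ltW/archi_boundP; rewrite divr_ge0 ?sqr_ge0.
have n0 : (0 : R) < n.+1%:R by rewrite ltr0Sn.
exists (bernstein n.+1 (fun i => h (i%:R / n.+1%:R))) => x x01.
pose v i : R := (i%:R - n.+1%:R * x) ^+ 2.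
pose c : R := M ^+ 2 / (2 * e) / n.+1%:R ^+ 2.
have vE i : M ^+ 2 / (2 * e) * (i%:R / n.+1%:R - x) ^+ 2 = c * v i.
  by rewrite /c /v; field; rewrite !gt_eqF.
have cv : c * (bernstein n.+1 v).[x] <= e / 2.
  rewrite bernstein_variance subrr expr0n/= add0r /c.
  have x1 : x * (1 - x) <= 1.
    by case/andP: x01 => ? ?; rewrite mulr_ile1// ?subr_ge0// gerBl.
  have x1' : 0 <= x * (1 - x).
    by case/andP: x01 => ? ?; rewrite mulr_ge0 ?subr_ge0.
  rewrite (_ : _ * _ = (M ^+ 2 / e ^+ 2) * (x * (1 - x)) * (e / 2) / n.+1%:R);
    last first.
    by field; rewrite !gt_eqF.
  rewrite ler_pdivrMr// [leRHS]mulrC; apply: ler_wpM2r.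
    by rewrite divr_ge0 ?ltW.
  rewrite -[leRHS]mulr1 ler_pM ?divr_ge0 ?sqr_ge0//.
  by rewrite (le_trans nM)// ler_nat.
rewrite ler_norml; apply/andP; split.
- rewrite lerBrDr addrC lerBlDr.
  have -> : h x + e = h x + e / 2 + e / 2 by field.
  apply: (@le_trans _ _ (bernstein n.+1
      ((fun=> h x + e / 2) \+ (fun i => c * v i))).[x]); last first.
    by rewrite bernsteinD bernstein_cst bernsteinZ lerD2l.
  apply: le_bernstein => // i /=; rewrite -vE.
  have := hC x (i%:R / n.+1%:R).
  by rewrite ler_norml => /andP[+ _]; rewrite lerNl opprB lerBlDl addrA.
- rewrite lerBlDr -lerBlDl.
  have -> : h x - e = h x - e / 2 - e / 2 by field.
  apply: (@le_trans _ _ (bernstein n.+1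
      ((fun=> h x - e / 2) \+ (fun i => - c * v i))).[x]).
    by rewrite bernsteinD bernstein_cst bernsteinZ lerD2l mulNr lerN2.
  apply: le_bernstein => // i /=; rewrite mulNr -vE.
  have := hC x (i%:R / n.+1%:R).
  by rewrite ler_norml => /andP[_]; rewrite lerBlDr -!lerBlDl opprD addrA.
Qed.

End bernstein.

(** * Exponential and Gamma integrals *)

Section gamma_integral.
Context {R : realType}.
Local Notation leb := (@lebesgue_measure R).

Lemma ge0_integral_dilation (g : R -> R) (c : R) : 0 < c ->
  {within `[0, +oo[, continuous g} -> (forall x, 0 < x -> 0 <= g x) ->
  (\int[leb]_(x in `]0%R, +oo[) (g (c * x))%:E =
   (c^-1)%:E * \int[leb]_(x in `]0%R, +oo[) (g x)%:E)%E.
Proof.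
move=> c0 cg g0.
have cgo : {in `]0, +oo[%R, continuous g}.
  by have /continuous_within_itvcyP[] := cg.
have mg : measurable_fun (`]0, +oo[ : set R) g.
  apply: open_continuous_measurable_fun => //.
  by move=> x; rewrite inE => x0; exact: cgo.
have dF (x : R) : is_derive x 1 ( *%R c) c.
  by rewrite (_ : *%R c = c *: id)//; apply: is_derive_eq;
    rewrite ?scaler0 ?scaler1 ?addr0 /GRing.scale /= ?mulr1.
have FE : derive1 ( *%R c) = cst c.
  by apply/funext => x; rewrite derive1E; exact: derive_val.
have mgc : measurable_fun (`]0, +oo[ : set R) (fun x => g (c * x)).
  apply: open_continuous_measurable_fun => // x.
  rewrite inE/= in_itv/= andbT => x0; apply: continuous_comp.
    exact: mulrl_continuous.
  by apply: cgo; rewrite in_itv/= andbT mulr_gt0.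
have H : (\int[leb]_(x in `[0%R, +oo[) (g x)%:E =
    \int[leb]_(x in `[0%R, +oo[) (g (c * x) * c)%:E)%E.
  have := @increasing_ge0_integration_by_substitutiony R ( *%R c) g 0.
  rewrite mulr0 FE; apply => //.
  - by move=> x y _ _ xy; rewrite ltr_pM2l.
  - by move=> x _; exact: cst_continuous.
  - exact: is_cvg_cst.
  - exact: is_cvg_cst.
  - split => [x _|]; first exact: ex_derive.
    by apply: cvg_at_right_filter; exact: mulrl_continuous.
  - exact: gt0_cvgMry.
  - by move=> x; rewrite in_itv/= andbT; exact: g0.
rewrite [in RHS]integral_itv_obnd_cbnd; last exact/measurable_EFinP.
rewrite H -integral_itv_obnd_cbnd; last first.
  by apply/measurable_EFinP/measurable_funM.
rewrite -ge0_integralZl_EFin//.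
- apply: eq_integral => x _ /=; rewrite -EFinM; congr EFin.
  by rewrite mulrCA mulVf ?gt_eqF// mulr1.
- move=> x; rewrite /= in_itv/= andbT => x0.
  by rewrite lee_fin mulr_ge0 ?g0 ?mulr_gt0// ltW.
- exact/measurable_EFinP/measurable_funM.
- by rewrite invr_ge0 ltW.
Qed.

Lemma integrable_expRN (c : R) : 0 < c ->
  leb.-integrable `]0, +oo[ (fun x => (expR (- (c * x)))%:E).
Proof.
move=> c0.
have H : leb.-integrable `]0, +oo[ (EFin \o exponential_pdf c).
  exact: integrableS (integrable_exponential_pdf c0).
apply: eq_integrable (integrableZl _ c^-1 H) => // x.
rewrite inE/= in_itv/= andbT => x0.
rewrite exponential_pdfE ?ltW// -EFinM mulNr; congr EFin.
by rewrite mulrA mulVf ?gt_eqF// mul1r.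
Qed.

Lemma continuous_powR_ge0 (rho : R) : 0 <= rho ->
  {within `[0, +oo[, continuous (fun x : R => x `^ rho)}.
Proof.
rewrite le_eqVlt => /predU1P[<-|rho0].
  apply: continuous_subspaceT.
  by under eq_fun do rewrite powRr0; exact: cst_continuous.
apply/continuous_within_itvcyP; split.
  move=> x; rewrite in_itv/= andbT => x0.
  apply/differentiable_continuous/derivable1_diffP/derivable_powR.
  by rewrite in_itv/= x0.
rewrite powR0 ?gt_eqF//.
exact: powR_cvg0.
Qed.

(** With [a = 2 * (rho + 1)], raise [y / a <= exp(y / a)] to the power [rho] and use
    [rho / a <= 1 / 2]; the [+ 1] keeps [a] positive at [rho = 0]. The rate [1 / 2] leaves an
    integrable [exp(- y / 2)] after multiplication by [exp(- y)]. *)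
Lemma powR_le_expR (rho y : R) : 0 <= rho -> 0 <= y ->
  y `^ rho <= (2 * (rho + 1)) `^ rho * expR (y / 2).
Proof.
move=> rho0 y0; set a := 2 * (rho + 1).
have a0 : 0 < a by rewrite /a; lra.
have ya : 0 <= y / a by rewrite divr_ge0// ltW.
rewrite (_ : y `^ rho = a `^ rho * (y / a) `^ rho); last first.
  by rewrite -powRM// ?(ltW a0)// mulrCA divff ?gt_eqF// mulr1.
apply: ler_wpM2l; first exact: powR_ge0.
apply: (@le_trans _ _ (expR (y / a) `^ rho)).
  apply: ge0_ler_powR => //; rewrite ?nnegrE ?expR_ge0//.
  by apply: le_trans (expR_ge1Dx _); lra.
rewrite -expRM ler_expR.
rewrite mulrAC -mulrA; apply: ler_wpM2l => //.
by rewrite ler_pdivrMr// mulrC /a; lra.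
Qed.

Lemma continuous_powR_expRN (rho : R) : 0 <= rho ->
  {within `[0, +oo[, continuous (fun x : R => x `^ rho * expR (- x))}.
Proof.
move=> rho0 x.
apply: cvgM; first exact: continuous_powR_ge0.
apply: continuous_subspaceT => {}x; apply: continuous_comp.
  exact: continuousN.
exact: continuous_expR.
Qed.

Lemma integrable_powR_expRN (rho : R) : 0 <= rho ->
  leb.-integrable `]0, +oo[ (fun x => (x `^ rho * expR (- x))%:E).
Proof.
move=> rho0.
have half0 : (0 : R) < 2^-1 by rewrite invr_gt0.
apply: le_integrable
  (integrableZl _ ((2 * (rho + 1)) `^ rho) (integrable_expRN half0)) => //.
- apply/measurable_EFinP/measurable_funM.
    by apply: measurable_funTS; exact: measurable_powR.
  by apply: measurable_funTS; apply: measurableT_comp.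
- move=> x; rewrite /= in_itv/= andbT => x0.
  rewrite !ger0_norm ?mulr_ge0 ?powR_ge0 ?expR_ge0// lee_fin.
  rewrite (_ : - (2^-1 * x) = 2^-1 * x - x); last by field.
  rewrite expRD mulrA; apply: ler_wpM2r; first exact: expR_ge0.
  by rewrite [2^-1 * _]mulrC powR_le_expR// ltW.
Qed.

Lemma EFin_Gamma (rho : R) : 0 <= rho -> (Gamma (rho + 1))%:E =
  (\int[leb]_(x in `]0%R, +oo[) (x `^ rho * expR (- x))%:E)%E.
Proof.
move=> rho0; rewrite /Gamma addrK fineK//; apply: integrable_fin_num => //.
exact: integrable_powR_expRN.
Qed.

Lemma integral_powR_expRN (rho c : R) : 0 <= rho -> 0 < c ->
  (\int[leb]_(x in `]0%R, +oo[) (x `^ rho * expR (- (c * x)))%:E =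
  (c `^ (- rho) / c * Gamma (rho + 1))%:E)%E.
Proof.
move=> rho0 c0.
have := ge0_integral_dilation c0 (continuous_powR_expRN rho0) _.
rewrite -EFin_Gamma// -EFinM -mulrA (EFinM (c `^ _)) => <-; last first.
  by move=> x _; rewrite mulr_ge0 ?powR_ge0 ?expR_ge0.
rewrite -ge0_integralZl_EFin ?powR_ge0//.
- apply: eq_integral => x; rewrite inE/= in_itv/= andbT => x0.
  rewrite -EFinM powRM ?ltW// 2!mulrA powRN mulVf ?mul1r//.
  by rewrite gt_eqF// powR_gt0.
- by move=> x _; rewrite lee_fin mulr_ge0 ?powR_ge0 ?expR_ge0.
- apply/measurable_EFinP/measurable_funM.
    apply: measurable_funTS; apply: (measurableT_comp (measurable_powR _)).
    exact: measurable_funM.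
  apply: measurable_funTS; apply: measurableT_comp => //.
  by apply: measurableT_comp => //; exact: measurable_funM.
Qed.

Lemma integrable_powR_expRNM (rho c : R) : 0 <= rho -> 0 < c ->
  leb.-integrable `]0, +oo[ (fun x => (x `^ rho * expR (- (c * x)))%:E).
Proof.
move=> rho0 c0; apply/integrableP; split.
  apply/measurable_EFinP/measurable_funM.
    by apply: measurable_funTS; exact: measurable_powR.
  apply: measurable_funTS; apply: measurableT_comp => //.
  exact: measurableT_comp.
under eq_integral.
  by move=> x _; rewrite gee0_abs ?lee_fin ?mulr_ge0 ?powR_ge0 ?expR_ge0//;
    over.
by rewrite integral_powR_expRN// ltry.
Qed.

Lemma integral_gt0_itv (f : R -> R) (a b c : R) : 0 <= a -> a < b -> 0 < c ->
  measurable_fun (`]0, +oo[ : set R) f -> (forall x, 0 < x -> 0 <= f x) ->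
  (forall x, a < x -> x < b -> c <= f x) ->
  (0 < \int[leb]_(x in `]0%R, +oo[) (f x)%:E)%E.
Proof.
move=> a0 ab c0 mf f0 cf.
have sub : (`]a, b[ : set R) `<=` `]0, +oo[.
  by move=> x; rewrite /= !in_itv/= andbT => /andP[ax _]; exact: le_lt_trans ax.
apply: (@lt_le_trans _ _ (\int[leb]_(x in `]a, b[) c%:E)%E).
  rewrite integral_cst//= lebesgue_measure_itv/= lte_fin ab -EFinB -EFinM.
  by rewrite lte_fin mulr_gt0// subr_gt0.
apply: (@le_trans _ _ (\int[leb]_(x in `]a, b[) (f x)%:E)%E).
  apply: ge0_le_integral => //.
  - by move=> x _; rewrite lee_fin ltW.
  - by apply/measurable_EFinP; exact: measurable_funS mf.
  - by move=> x; rewrite /= in_itv/= => /andP[? ?]; rewrite lee_fin cf.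
apply: ge0_subset_integral => //.
- exact/measurable_EFinP.
- by move=> x; rewrite /= in_itv/= andbT lee_fin; exact: f0.
Qed.

Lemma Gamma_gt0 (rho : R) : 0 <= rho -> 0 < Gamma (rho + 1).
Proof.
move=> rho0; rewrite -lte_fin EFin_Gamma//.
apply: (@integral_gt0_itv _ 1 2 (expR (- 2))) => //.
- by rewrite ltr1n.
- apply: measurable_funM.
    by apply: measurable_funTS; exact: measurable_powR.
  by apply: measurable_funTS; apply: measurableT_comp.
- by move=> x _; rewrite mulr_ge0 ?powR_ge0 ?expR_ge0.
- move=> x x1 x2; rewrite -[leLHS]mul1r ler_pM ?expR_ge0//.
    rewrite (_ : 1 = 1 `^ rho); last by rewrite powR1.
    by rewrite ge0_ler_powR ?nnegrE// ltW// (lt_trans _ x1).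
  by rewrite ler_expR lerN2 ltW.
Qed.

End gamma_integral.

(** * Convergence of moments *)

Section moments.
Context d (T : measurableType d) (R : realType).
Variables (mu : {measure set T -> \bar R}) (D : set T) (mD : measurable D).
Implicit Types (w th : T -> R) (h : R -> R).

(** The image under [th] of the measure with density [w] is then a finite measure on [0, 1], and
    [wint] integrates against it without constructing it. Both [w] and [th] may vary along a
    filter. *)
Definition weighted w th := [/\ mu.-integrable D (EFin \o w),
  measurable_fun D th, forall x, D x -> 0 <= w x &
  forall x, D x -> 0 <= th x <= 1].

Definition wint w th h : R := \int[mu]_(x in D) (w x * h (th x)).

Lemma integrable_wint w th h : weighted w th -> continuous h ->
  mu.-integrable D (fun x => (w x * h (th x))%:E).
Proof.
move=> [iw mth w0 th01] ch.
have ch01 : {within `[0, 1], continuous (fun x => `|h x|)}.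
  by apply: continuous_subspaceT => x; apply: continuous_comp;
    [exact: ch|exact: norm_continuous].
have [c _ hc] := EVT_max ler01 ch01.
apply: le_integrable (integrableZl mD `|h c| iw) => //.
- apply/measurable_EFinP/measurable_funM.
    exact/measurable_EFinP/(measurable_int mu).
  by apply: measurableT_comp => //; exact: continuous_measurable_fun.
- move=> x Dx; rewrite lee_fin /= !normrM normr_id mulrC.
  by rewrite ler_wpM2r// hc// in_itv/= th01.
Qed.

Lemma wintD w th h1 h2 : weighted w th -> continuous h1 -> continuous h2 ->
  wint w th (h1 \+ h2) = wint w th h1 + wint w th h2.
Proof.
move=> wth c1 c2; rewrite /wint -RintegralD//; try exact: integrable_wint.
by apply: eq_Rintegral => x _; rewrite /= mulrDr.
Qed.

Lemma wintZ w th c h : weighted w th -> continuous h ->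
  wint w th (fun u => c * h u) = c * wint w th h.
Proof.
move=> wth ch; rewrite /wint -RintegralZl//; last exact: integrable_wint.
by apply: eq_Rintegral => x _; rewrite mulrCA.
Qed.

Lemma weightedZ (c : R) w th : 0 <= c -> weighted w th ->
  weighted (fun x => c * w x) th.
Proof.
move=> c0 [iw mth w0 th01]; split => //.
  by apply: eq_integrable (integrableZl mD c iw) => // x _; rewrite -EFinM.
by move=> x Dx; rewrite mulr_ge0 ?w0.
Qed.

Lemma wintZw c w th h : weighted w th -> continuous h ->
  wint (fun x => c * w x) th h = c * wint w th h.
Proof.
move=> wth ch; rewrite /wint -RintegralZl//; last exact: integrable_wint.
by apply: eq_Rintegral => x _; rewrite mulrA.
Qed.

Lemma le_wint w th h1 h2 : weighted w th -> continuous h1 -> continuous h2 ->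
  (forall u, 0 <= u <= 1 -> h1 u <= h2 u) -> wint w th h1 <= wint w th h2.
Proof.
move=> wth c1 c2 h12; apply: le_Rintegral => //; try exact: integrable_wint.
by case: wth => _ _ w0 th01 x Dx; rewrite ler_wpM2l ?w0// h12// th01.
Qed.

Lemma wint_dist w th h1 h2 (e : R) :
  weighted w th -> continuous h1 -> continuous h2 ->
  (forall u, 0 <= u <= 1 -> `|h1 u - h2 u| <= e) ->
  `|wint w th h1 - wint w th h2| <= e * wint w th (fun=> 1).
Proof.
move=> wth c1 c2 h12.
have cc : continuous (fun _ : R => e * 1 : R) by move=> x; exact: cvg_cst.
rewrite -wintZ//; last by move=> x; exact: cvg_cst.
rewrite ler_distl lerBlDr -!wintD//.
have cD (h : R -> R) : continuous h -> continuous (h \+ fun=> e * 1).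
  by move=> ch x; apply: cvgD; [exact: ch|exact: cc].
apply/andP; split; apply: le_wint => //; try exact: cD.
  move=> u /h12; rewrite ler_norml => /andP[+ _].
  by rewrite /= mulr1 lerBrDr addrC lerBlDr.
move=> u /h12; rewrite ler_norml => /andP[_].
by rewrite /= mulr1 lerBlDr addrC.
Qed.

Lemma cvg_wint_poly (I : Type) (F : set_system I) (w th : I -> T -> R)
    (w0 th0 : T -> R) : Filter F ->
  (\forall i \near F, weighted (w i) (th i)) -> weighted w0 th0 ->
  (forall n, wint (w i) (th i) (fun u => u ^+ n) @[i --> F] -->
    wint w0 th0 (fun u => u ^+ n)) ->
  forall p : {poly R}, wint (w i) (th i) (horner p) @[i --> F] -->
    wint w0 th0 (horner p).
Proof.
move=> FF wth wth0 hn p; have cX n : continuous (fun u : R => u ^+ n).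
  exact: exprn_continuous.
(* The extra factor [u ^+ n] absorbs the ['X] of the Horner step [p * 'X + c], which is what makes
   the induction on [p] close. *)
suff H n : wint (w i) (th i) (fun u => u ^+ n * p.[u]) @[i --> F] -->
    wint w0 th0 (fun u => u ^+ n * p.[u]).
  have := H 0%N; rewrite (_ : (fun u => u ^+ 0 * p.[u]) = horner p)//.
  by apply/funext => u; rewrite expr0 mul1r.
elim/poly_ind: p n => [n|p c IH n].
  have E w' th' : wint w' th' (fun u => u ^+ n * 0.[u]) = 0.
    rewrite /wint /Rintegral integral0_eq// => x _.
    by rewrite horner0 !mulr0.
  rewrite E; under eq_cvg do rewrite E; exact: cvg_cst.
have E w' th' : weighted w' th' -> wint w' th' (fun u => u ^+ n * (p * 'X + c%:P).[u]) =
    wint w' th' (fun u => u ^+ n.+1 * p.[u]) + c * wint w' th' (fun u => u ^+ n).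
  move=> wth'; rewrite -wintZ// -wintD//.
  - by congr wint; apply/funext => u /=; rewrite !hornerE exprS; ring.
  - by move=> u; apply: cvgM; [exact: cX|exact: continuous_horner].
  - by move=> u; apply: cvgM; [exact: cvg_cst|exact: cX].
rewrite E//; apply: cvg_trans (cvgD (IH n.+1) (cvgM (cvg_cst c) (hn n))).
by apply: near_eq_cvg; apply: filterS wth => i wthi; rewrite E.
Qed.

Lemma cvg_wint_lipschitz (I : Type) (F : set_system I) (w th : I -> T -> R)
    (w0 th0 : T -> R) (h : R -> R) (M : R) : Filter F ->
  (\forall i \near F, weighted (w i) (th i)) -> weighted w0 th0 ->
  (forall n, wint (w i) (th i) (fun u => u ^+ n) @[i --> F] -->
    wint w0 th0 (fun u => u ^+ n)) ->
  (forall x y, `|h x - h y| <= M * `|x - y|) -> continuous h ->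
  wint (w i) (th i) h @[i --> F] --> wint w0 th0 h.
Proof.
move=> FF wth wth0 hn hM ch; apply/cvgrPdist_le => e e0.
pose m := wint w0 th0 (fun=> 1).
have m0 : 0 <= m.
  by apply: Rintegral_ge0 => x Dx; rewrite mulr1; case: wth0 => _ _ + _; exact.
(* The moment of order 0 tends to [m], so the masses are eventually at most [m + 1]. The two uniform
   approximations then cost [dl * m + dl * (m + 1) = e / 2], which leaves [e / 2] for the
   polynomial. *)
pose dl := e / (2 * (2 * m + 1)).
have dl0 : 0 < dl by rewrite divr_gt0// mulr_gt0// ltr_wpDl// mulr_ge0.
have [p hp] := lipschitz_polynomial_approx dl0 hM.
have cp : continuous (horner p) by move=> x; exact: continuous_horner.
have e2 : 0 < e / 2 by rewrite divr_gt0.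
have mn : wint (w i) (th i) (fun=> 1) @[i --> F] --> m by exact: (hn 0%N).
near=> i.
have wi : weighted (w i) (th i) by near: i.
have hpi : `|wint w0 th0 (horner p) - wint (w i) (th i) (horner p)| <= e / 2.
  near: i; move: e2; move: (e / 2); apply/cvgrPdist_le.
  exact: cvg_wint_poly.
have mi : wint (w i) (th i) (fun=> 1) <= m + 1.
  near: i; move/cvgrPdist_le : mn => /(_ _ ltr01).
  by apply: filterS => i; rewrite ler_distlC => /andP[_].
have h1 := wint_dist wth0 ch cp hp.
have h2 := wint_dist wi ch cp hp.
have h3 : dl * wint (w i) (th i) (fun=> 1) <= dl * (m + 1).
  by rewrite ler_wpM2l// ltW.
have h4 : dl * m + dl * (m + 1) = e / 2.
  by rewrite /dl; field; rewrite gt_eqF// ltr_wpDl// mulr_ge0.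
move: h1 h2 hpi; rewrite -/m !ler_norml => /andP[? ?] /andP[? ?] /andP[? ?].
by apply/andP; split; lra.
Unshelve. all: by end_near. Qed.

End moments.

(** * Karamata's Tauberian theorem *)

Section karamata.
Context {R : realType}.
Local Notation leb := (@lebesgue_measure R).

(** A Lipschitz substitute for the indicator of an interval. It is used at [u = exp(- y)] with ends
    [exp(- be)] and [exp(- al)], so that it selects [al < y < be]. *)
Definition tent (a b u : R) := Num.max 0 (Num.min (u - a) (b - u)).

Lemma tent_ge0 a b u : 0 <= tent a b u.
Proof. by rewrite le_max lexx. Qed.

Lemma tent_gt0 a b u : (0 < tent a b u) = (a < u < b).
Proof. by rewrite lt_max ltxx/= lt_min !subr_gt0. Qed.

Lemma tent_lipschitz a b u v : `|tent a b u - tent a b v| <= 1 * `|u - v|.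
Proof.
rewrite mul1r /tent /Num.max /Num.min; set d := `|u - v|.
have [? ?] : u - v <= d /\ v - u <= d.
  by rewrite ler_norm /d distrC ler_norm.
by rewrite ler_norml; do ?case: ifPn => //; rewrite -?leNgt => *; apply/andP;
  split; lra.
Qed.

Lemma continuous_tent a b : continuous (tent a b).
Proof.
move=> u; apply/cvgrPdist_le => e e0; near=> v.
apply: (le_trans (tent_lipschitz _ _ _ _)); rewrite mul1r; near: v.
exact: cvgr_dist_le.
Unshelve. all: by end_near. Qed.

Lemma cvg_div_pinfty_at_right (c : R) : 0 < c ->
  c / t @[t --> +oo] --> 0^'+.
Proof.
move=> c0 A [e /= e0 eA].
suff : \forall t \near +oo, A (c / t) by [].
near=> t.
have t0 : 0 < t by near: t; apply: nbhs_pinfty_gt; rewrite num_real.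
apply: eA => /=; last by rewrite divr_gt0.
rewrite sub0r normrN gtr0_norm ?divr_gt0// ltr_pdivrMr// mulrC -ltr_pdivrMr//.
by near: t; apply: nbhs_pinfty_gt; rewrite ?num_real.
Unshelve. all: by end_near. Qed.

Definition decay (c s : R) : R := expR (- (c * s)).

Local Notation wint := (wint leb `]0, +oo[).
Local Notation weighted := (weighted leb `]0, +oo[).

Let mpos : measurable (`]0, +oo[ : set (measurableTypeR R)).
Proof. exact: measurable_itv. Qed.

Lemma measurable_decay c : measurable_fun setT (decay c).
Proof.
by apply: measurableT_comp => //; apply: measurableT_comp.
Qed.

Lemma decay_itv01 c s : 0 < c -> 0 < s -> 0 <= decay c s <= 1.
Proof.
move=> c0 s0; rewrite expR_ge0/= -expR0 ler_expR oppr_le0.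
by rewrite mulr_ge0 ?ltW.
Qed.

Lemma weighted_decay c (w : R -> R) : 0 < c ->
  leb.-integrable `]0, +oo[ (EFin \o w) -> (forall s, 0 < s -> 0 <= w s) ->
  weighted w (decay c).
Proof.
move=> c0 iw w0; split => //.
- by apply: measurable_funTS; exact: measurable_decay.
- by move=> x; rewrite /= in_itv/= andbT => /w0.
- by move=> x; rewrite /= in_itv/= andbT; exact: decay_itv01.
Qed.

Lemma weighted_decay_decay c : 0 < c -> weighted (decay c) (decay c).
Proof.
move=> c0; apply: weighted_decay => //; first exact: integrable_expRN.
by move=> s _; exact: expR_ge0.
Qed.

(** The substitution [y = c * s] expresses the comparison weights at all scales through one constant
    that does not depend on the scale. For a tent this constant is positive, hence can be
    cancelled. *)
Lemma wint_decay (c : R) (h : R -> R) : 0 < c -> continuous h ->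
  (forall u, 0 <= h u) ->
  wint (decay c) (decay c) h = c^-1 * wint (decay 1) (decay 1) h.
Proof.
move=> c0 ch h0.
have cd x : {for x, continuous (decay 1)}.
  apply: continuous_comp; last exact: continuous_expR.
  by apply: continuousN; exact: mulrl_continuous.
have cg : {within `[0, +oo[, continuous (fun x => decay 1 x * h (decay 1 x))}.
  apply: continuous_subspaceT => x; apply: cvgM; first exact: cd.
  by apply: continuous_comp; [exact: cd|exact: ch].
have E x : decay 1 (c * x) = decay c x by rewrite /decay mul1r.
have := ge0_integral_dilation c0 cg _.
under eq_integral do rewrite E.
rewrite /wint /Rintegral => ->; last first.
  by move=> x _; rewrite mulr_ge0 ?expR_ge0.
rewrite fineM//; apply: integrable_fin_num => //.
by apply: integrable_wint => //; exact: weighted_decay_decay.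
Qed.

Lemma wint_tent_gt0 (al be : R) : 0 <= al -> al < be ->
  0 < wint (decay 1) (decay 1) (tent (expR (- be)) (expR (- al))).
Proof.
move=> al0 albe; set h := tent _ _.
have iJ := integrable_wint mpos (weighted_decay_decay ltr01)
  (@continuous_tent (expR (- be)) (expR (- al))).
rewrite -lte_fin fineK; last exact: integrable_fin_num.
pose f y := decay 1 y * h (decay 1 y).
(* On the middle third of the interval the tent stays away from both of its zeros, hence above the
   constant [m]. *)
pose x1 := al + (be - al) / 3; pose x2 := al + 2 * (be - al) / 3.
pose m := Num.min (expR (- x2) - expR (- be)) (expR (- al) - expR (- x1)).
have m0 : 0 < m.
  by rewrite lt_min !subr_gt0 !ltr_expR /x1 /x2 ; apply/andP; split; lra.
apply: (@integral_gt0_itv _ f x1 x2 (expR (- be) * m)).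
- by rewrite /x1; lra.
- by rewrite /x1 /x2; lra.
- by rewrite mulr_gt0 ?expR_gt0.
- by apply/measurable_EFinP; exact: (measurable_int leb).
- by move=> y _; rewrite mulr_ge0 ?expR_ge0 ?tent_ge0.
- move=> y y1 y2; have yb : y <= be by move: y2; rewrite /x2; lra.
  rewrite /f /decay mul1r; apply: ler_pM; rewrite ?expR_ge0 ?(ltW m0)//.
    by rewrite ler_expR lerN2.
  rewrite le_max; apply/orP; right; rewrite le_min !ge_min; apply/andP; split.
    by rewrite lerD2r ler_expR lerN2; apply/orP; left; exact: ltW.
  by rewrite lerD2l lerN2 ler_expR lerN2; apply/orP; right; exact: ltW.
Qed.

Lemma le_wint_tent (c al be : R) (w1 w2 : R -> R) : 0 < c ->
  weighted w1 (decay c) -> weighted w2 (decay c) ->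
  (forall s, 0 < s -> al < c * s < be -> w1 s <= w2 s) ->
  wint w1 (decay c) (tent (expR (- be)) (expR (- al))) <=
  wint w2 (decay c) (tent (expR (- be)) (expR (- al))).
Proof.
move=> c0 wth1 wth2 w12; have ct := @continuous_tent (expR (- be)) (expR (- al)).
apply: le_Rintegral => //; try exact: integrable_wint.
move=> s; rewrite /= in_itv/= andbT => s0.
have := tent_ge0 (expR (- be)) (expR (- al)) (decay c s).
rewrite le_eqVlt => /predU1P[<-|t0]; first by rewrite !mulr0.
apply: ler_wpM2r; first exact: ltW.
apply: w12 => //; move: t0.
by rewrite tent_gt0 !ltr_expR !ltrN2 andbC.
Qed.

Section tauberian.
Variables (U K : R -> R) (rho C : R).
Hypothesis rho0 : 0 <= rho.
Hypothesis U0 : forall s, 0 < s -> 0 <= U s.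
Hypothesis U_nd : forall s t, 0 < s -> s <= t -> U s <= U t.
Hypothesis U_int : forall l, 0 < l ->
  leb.-integrable `]0, +oo[ (fun s => (expR (- (l * s)) * U s)%:E).
Hypothesis K0 : forall l, 0 < l -> 0 < K l.
Hypothesis K_rv : forall c, 0 < c ->
  K (c / t) / K t^-1 @[t --> +oo] --> c `^ (- rho).
Hypothesis U_K :
  l * (\int[leb]_(s in `]0, +oo[) (expR (- (l * s)) * U s)) / K l
    @[l --> 0^'+] --> C.

(** [w t] is paired with [decay t^-1], and its limit [w0], written in the variable [y = s / t], with
    [decay 1]: both are thereby compared as measures on [0, 1]. *)
Let w t s := (t * K t^-1)^-1 * (decay t^-1 s * U s).
Let g := C / Gamma (rho + 1).
Let w0 y := g * (y `^ rho * expR (- y)).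

Let C_ge0 : 0 <= C.
Proof.
rewrite -(cvg_lim _ U_K)//; apply: limr_ge; first by apply/cvg_ex; exists C.
near=> l; have l0 : 0 < l by near: l; exact: nbhs_right_gt.
rewrite divr_ge0 ?(ltW (K0 l0))// mulr_ge0 ?(ltW l0)//.
apply: Rintegral_ge0 => s; rewrite /= in_itv/= andbT => s0.
by rewrite mulr_ge0 ?expR_ge0 ?U0.
Unshelve. all: by end_near. Qed.

Let g_ge0 : 0 <= g.
Proof. by rewrite divr_ge0 ?(ltW (Gamma_gt0 rho0)). Qed.

Let tK0 t : 0 < t -> 0 < (t * K t^-1)^-1.
Proof. by move=> t0; rewrite invr_gt0 mulr_gt0// K0 ?invr_gt0. Qed.

Let weighted_w t : 0 < t -> weighted (w t) (decay t^-1).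
Proof.
move=> t0; apply: weighted_decay; first by rewrite invr_gt0.
- have t1 : 0 < t^-1 by rewrite invr_gt0.
  by apply: eq_integrable
    (integrableZl mpos ((t * K t^-1)^-1) (U_int t1)) => // x _; rewrite -EFinM.
- move=> s s0; rewrite /w mulr_ge0 ?(ltW (tK0 t0))// mulr_ge0 ?U0//.
  exact: expR_ge0.
Qed.

Let weighted_w0 : weighted w0 (decay 1).
Proof.
apply: weighted_decay => //.
- by apply: eq_integrable
    (integrableZl mpos g (integrable_powR_expRN rho0)) => // x _; rewrite -EFinM.
- by move=> s s0; apply: mulr_ge0; [exact: g_ge0|rewrite mulr_ge0 ?powR_ge0 ?expR_ge0].
Qed.

Let moment_w t n : 0 < t -> let l := n.+1%:R / t in
  wint (w t) (decay t^-1) (fun u => u ^+ n) =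
  (l * (\int[leb]_(s in `]0, +oo[) (expR (- (l * s)) * U s)) / K l) *
  (K l / K t^-1) / n.+1%:R.
Proof.
move=> t0 l; have l0 : 0 < l by rewrite divr_gt0.
have kn0 : K t^-1 != 0 by rewrite gt_eqF// K0 ?invr_gt0.
rewrite [RHS](_ : _ = (t * K t^-1)^-1 *
    \int[leb]_(s in `]0, +oo[) (expR (- (l * s)) * U s)); last first.
  by rewrite /l; field; rewrite kn0 !gt_eqF// K0.
rewrite -RintegralZl//; last exact: U_int.
apply: eq_Rintegral => s _; rewrite /w -mulrA; congr *%R.
rewrite mulrAC; congr *%R; rewrite /decay -exprS -expRM_natl; congr expR.
by rewrite /l; ring.
Qed.

Let moment_w0 n : wint w0 (decay 1) (fun u => u ^+ n) =
  C * n.+1%:R `^ (- rho) / n.+1%:R.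
Proof.
transitivity (g * \int[leb]_(y in `]0, +oo[)
    (y `^ rho * expR (- (n.+1%:R * y)))); last first.
  rewrite /Rintegral integral_powR_expRN//= /g.
  by field; rewrite !gt_eqF// Gamma_gt0.
rewrite -RintegralZl//; last exact: integrable_powR_expRNM.
apply: eq_Rintegral => y _; rewrite /w0 /decay -!mulrA mul1r; congr (_ * (_ * _)).
by rewrite -mulrN expRM_natl exprS.
Qed.

Let cvg_moment n : wint (w t) (decay t^-1) (fun u => u ^+ n) @[t --> +oo] -->
  wint w0 (decay 1) (fun u => u ^+ n).
Proof.
rewrite moment_w0.
pose f (l : R) := l * (\int[leb]_(s in `]0, +oo[) (expR (- (l * s)) * U s)) / K l.
have H : f (n.+1%:R / t) @[t --> +oo] --> C.
  exact: cvg_comp (cvg_div_pinfty_at_right (ltr0Sn R n)) U_K.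
have H2 : f (n.+1%:R / t) * (K (n.+1%:R / t) / K t^-1) / n.+1%:R @[t --> +oo] -->
    C * n.+1%:R `^ (- rho) / n.+1%:R.
  by apply: cvgM; [apply: cvgM => //; exact: K_rv|exact: cvg_cst].
apply: cvg_trans H2; apply: near_eq_cvg.
near=> t.
by rewrite moment_w//; near: t; apply: nbhs_pinfty_gt; rewrite num_real.
Unshelve. all: by end_near. Qed.

Let cvg_wint_tent a b :
  wint (w t) (decay t^-1) (tent a b) @[t --> +oo] --> wint w0 (decay 1) (tent a b).
Proof.
apply: (@cvg_wint_lipschitz _ _ _ leb _ mpos _ _ w (fun t => decay t^-1) _ _ _
  1) => //.
- near=> t; apply: weighted_w.
  by near: t; apply: nbhs_pinfty_gt; rewrite num_real.
- exact: tent_lipschitz.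
- exact: continuous_tent.
Unshelve. all: by end_near. Qed.

Let weighted_cst t (c : R) : 0 < t -> 0 <= c ->
  weighted (fun s => c * decay t s) (decay t).
Proof. by move=> t0 c0; apply: weightedZ => //; exact: weighted_decay_decay. Qed.

Let wint_cst t c al be : 0 < t ->
  wint (fun s => c * decay t s) (decay t) (tent (expR (- be)) (expR (- al))) =
  c / t * wint (decay 1) (decay 1) (tent (expR (- be)) (expR (- al))).
Proof.
move=> t0; rewrite wintZw//.
- by rewrite wint_decay ?mulrA//; [exact: continuous_tent|exact: tent_ge0].
- exact: weighted_decay_decay.
- exact: continuous_tent.
Qed.

(* As [tent] vanishes unless [al < s / t < be] and [U] is monotone, comparing
   [U s] with [U t] in [wint (w t)] bounds [U t] from above when [1 <= al] and
   from below when [be <= 1]. *)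
Let tent_limit_ub (al be e : R) : 0 <= al -> al < be -> 0 < e ->
  \forall t \near +oo, wint (w t) (decay t^-1) (tent (expR (- be)) (expR (- al))) <=
    (g * be `^ rho + e) * wint (decay 1) (decay 1) (tent (expR (- be)) (expR (- al))).
Proof.
move=> al0 albe e0; have H0 := wint_tent_gt0 al0 albe.
set H := wint _ _ _ in H0 *.
have eH : 0 < e * H by rewrite mulr_gt0.
have be0 : 0 <= be by rewrite ltW// (le_lt_trans al0).
have le0 : wint w0 (decay 1) (tent (expR (- be)) (expR (- al))) <=
    g * be `^ rho * H.
  rewrite -[g * _]divr1 -wint_cst//; apply: le_wint_tent => //.
    by apply: weighted_cst => //; rewrite mulr_ge0 ?powR_ge0.
  move=> s s0; rewrite mul1r => /andP[_ /ltW sbe].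
  rewrite /w0 mulrA /decay mul1r; apply: ler_wpM2r; first exact: expR_ge0.
  apply: ler_wpM2l => //.
  by rewrite ge0_ler_powR// nnegrE ltW.
have /cvgrPdist_le/(_ _ eH) := @cvg_wint_tent (expR (- be)) (expR (- al)).
apply: filterS => t; rewrite ler_distlC => /andP[_ /le_trans]; apply.
by rewrite mulrDl lerD2r.
Qed.

Let tent_limit_lb (al be e : R) : 0 <= al -> al < be -> 0 < e ->
  \forall t \near +oo, (g * al `^ rho - e) *
    wint (decay 1) (decay 1) (tent (expR (- be)) (expR (- al))) <=
    wint (w t) (decay t^-1) (tent (expR (- be)) (expR (- al))).
Proof.
move=> al0 albe e0; have H0 := wint_tent_gt0 al0 albe.
set H := wint _ _ _ in H0 *.
have eH : 0 < e * H by rewrite mulr_gt0.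
have le0 : g * al `^ rho * H <=
    wint w0 (decay 1) (tent (expR (- be)) (expR (- al))).
  rewrite -[g * _]divr1 -wint_cst//; apply: le_wint_tent => //.
    by apply: weighted_cst => //; rewrite mulr_ge0 ?powR_ge0.
  move=> s s0; rewrite mul1r => /andP[/ltW als _].
  rewrite /w0 mulrA /decay mul1r; apply: ler_wpM2r; first exact: expR_ge0.
  apply: ler_wpM2l => //.
  by rewrite ge0_ler_powR// nnegrE ltW.
have /cvgrPdist_le/(_ _ eH) := @cvg_wint_tent (expR (- be)) (expR (- al)).
apply: filterS => t; rewrite ler_distlC => /andP[+ _]; apply: le_trans.
by rewrite mulrBl lerD2r.
Qed.

Theorem karamata_tauberian : U t / K t^-1 @[t --> +oo] --> g.
Proof.
have : {for (1 : R), continuous (fun x => x `^ rho)}.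
  apply/differentiable_continuous/derivable1_diffP/derivable_powR.
  by rewrite in_itv/= ltr01.
rewrite /prop_for /continuous_at /= powR1 => cpow.
have cg : g * x `^ rho @[x --> (1 : R)] --> g.
  by rewrite -[X in _ --> X]mulr1; apply: cvgM cpow; exact: cvg_cst.
apply/cvgrPdist_le => e e0.
have e2 : 0 < e / 2 by rewrite divr_gt0.
have /cvgrPdist_le/(_ _ e2)[/= d d0 hd] := cg.
(* [d / 2] keeps [1 - dl] and [1 + dl] strictly within distance [d] of 1; [1 / 2] keeps [1 - dl]
   non-negative. *)
pose dl := Num.min (d / 2) (1 / 2).
have dl0 : 0 < dl by rewrite lt_min !divr_gt0.
have [dld dl1] : dl < d /\ dl < 1.
  by rewrite !gt_min; split; apply/orP; [left|right]; lra.
have hbe : g * (1 + dl) `^ rho <= g + e / 2.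
  have /hd : `|1 - (1 + dl)| < d by rewrite opprD addNKr normrN gtr0_norm.
  by rewrite ler_distlC => /andP[].
have hal : g - e / 2 <= g * (1 - dl) `^ rho.
  have /hd : `|1 - (1 - dl)| < d by rewrite subKr gtr0_norm.
  by rewrite ler_distlC => /andP[].
have ub1 : 1 < 1 + dl by rewrite ltrDl.
have lb1 : 1 - dl < 1 by rewrite gtrBl.
have lb0 : 0 <= 1 - dl by rewrite subr_ge0 ltW.
near=> t.
have t0 : 0 < t by near: t; apply: nbhs_pinfty_gt; rewrite num_real.
have t'0 : 0 < t^-1 by rewrite invr_gt0.
have Kt : K t^-1 != 0 by rewrite gt_eqF// K0.
(* This is the form of [wint_cst] at rate [t^-1]: multiplied by the tent constant, it is the tent
   integral of the weight [w t] with [U s] frozen at [U t]. *)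
have UE : U t / K t^-1 = (t * K t^-1)^-1 * U t / t^-1.
  by field; rewrite gt_eqF// Kt.
have UKge0 : 0 <= (t * K t^-1)^-1 * U t by rewrite mulr_ge0 ?U0// ltW// tK0.
rewrite ler_distlC; apply/andP; split.
- have H0 := wint_tent_gt0 lb0 lb1.
  rewrite -(ler_pM2r H0) UE -wint_cst//.
  apply: (@le_trans _ _ (wint (w t) (decay t^-1)
      (tent (expR (- 1)) (expR (- (1 - dl)))))); last first.
    apply: le_wint_tent => //; [exact: weighted_w|exact: weighted_cst|].
    move=> s s0 /andP[_ st]; rewrite /w [decay _ _ * _]mulrC mulrA.
    apply: ler_wpM2r; first exact: expR_ge0.
    apply: ler_wpM2l; first by rewrite ltW// tK0.
    by apply: U_nd => //; move: st; rewrite mulrC ltr_pdivrMr// mul1r => /ltW.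
  apply: (@le_trans _ _ ((g * (1 - dl) `^ rho - e / 2) *
     wint (decay 1) (decay 1) (tent (expR (- 1)) (expR (- (1 - dl)))))).
    by rewrite ler_pM2r//; lra.
  by near: t; exact: tent_limit_lb.
- have H0 := wint_tent_gt0 ler01 ub1.
  rewrite -(ler_pM2r H0) UE -wint_cst//.
  apply: (@le_trans _ _ (wint (w t) (decay t^-1)
      (tent (expR (- (1 + dl))) (expR (- 1))))).
    apply: le_wint_tent => //; [exact: weighted_cst|exact: weighted_w|].
    move=> s s0 /andP[st _]; rewrite /w [decay _ _ * _]mulrC mulrA.
    apply: ler_wpM2r; first exact: expR_ge0.
    apply: ler_wpM2l; first by rewrite ltW// tK0.
    by apply: U_nd => //; move: st; rewrite mulrC ltr_pdivlMr// mul1r => /ltW.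
  apply: (@le_trans _ _ ((g * (1 + dl) `^ rho + e / 2) *
     wint (decay 1) (decay 1) (tent (expR (- (1 + dl))) (expR (- 1))))).
    by near: t; exact: tent_limit_ub.
  by rewrite ler_pM2r//; lra.
Unshelve. all: by end_near. Qed.

End tauberian.
End karamata.

(** * Measures with a density *)

Section density.
Local Open Scope ereal_scope.
Context d (T : measurableType d) (R : realType).
Variables (mu nu : {measure set T -> \bar R}) (D : set T) (g : T -> R).
Hypotheses (mD : measurable D) (mg : measurable_fun D g).
Hypothesis g0 : forall x, D x -> (0 <= g x)%R.
Hypothesis nuE : forall B, measurable B -> B `<=` D ->
  nu B = \int[mu]_(x in B) (g x)%:E.

Import HBNNSimple.

Let integral_density_indic (A : set T) (k : R) : measurable A -> (0 <= k)%R ->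
  \int[nu]_(x in D) (k * \1_A x)%:E = \int[mu]_(x in D) (k * \1_A x * g x)%:E.
Proof.
move=> mA k0.
transitivity (k%:E * \int[nu]_(x in D) (\1_A x)%:E).
  rewrite -ge0_integralZl_EFin//.
  exact/measurable_EFinP/measurable_funTS.
transitivity (k%:E * \int[mu]_(x in D) (\1_A x * g x)%:E); last first.
  rewrite -ge0_integralZl_EFin//.
  - by apply: eq_integral => x _; rewrite -EFinM mulrA.
  - by move=> x Dx; rewrite lee_fin mulr_ge0 ?g0.
  - exact/measurable_EFinP/measurable_funM.
congr *%E; rewrite integral_indic// nuE//; last exact: measurableI.
rewrite integral_mkcondl; apply: eq_integral => x _.
by rewrite epatch_indic muleC EFinM.
Qed.

Let integral_density_nnsfun (h : {nnsfun T >-> R}) :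
  \int[nu]_(x in D) (h x)%:E = \int[mu]_(x in D) (h x * g x)%:E.
Proof.
pose a (r : R) x : R := (r * \1_(h @^-1` [set r]) x)%R.
have a0 r x : (0 <= a r x)%R.
  by have := nnfun_muleindic_ge0 h r x; rewrite lee_fin.
have ma r : measurable_fun D (a r).
  by apply: measurable_funM.
transitivity (\int[nu]_(x in D) \sum_(r \in range h) (a r x)%:E).
  by apply: eq_integral => x _; rewrite fimfunE fsumEFin.
rewrite ge0_integral_fsum//; last 2 first.
  by move=> r; exact/measurable_EFinP.
  by move=> r x _; rewrite lee_fin.
transitivity (\int[mu]_(x in D) \sum_(r \in range h) (a r x * g x)%:E); last first.
  apply: eq_integral => x; rewrite inE => Dx.
  rewrite fimfunE EFinM -fsumEFin// ge0_mule_fsuml//.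
  by move=> r; rewrite lee_fin; exact: a0.
rewrite ge0_integral_fsum//; last 2 first.
  by move=> r; exact/measurable_EFinP/measurable_funM.
  by move=> r x Dx; rewrite lee_fin mulr_ge0 ?g0.
apply: eq_fsbigr => r; rewrite inE => -[x _ <-].
by apply: integral_density_indic.
Qed.

(** Monotone approximation by simple functions. Since [nuE] speaks only of subsets of [D], [nu] may
    charge the complement of [D]. This matters for the passage time, whose infinite values are
    recorded as 0, outside the open half-line. *)
Lemma integral_density (f : T -> \bar R) : measurable_fun D f ->
  (forall x, D x -> 0 <= f x) ->
  \int[nu]_(x in D) f x = \int[mu]_(x in D) (f x * (g x)%:E).
Proof.
move=> mf f0; pose h := nnsfun_approx mD mf.
have hf x : D x -> (h n x)%:E @[n --> \oo] --> f x.
  by move=> Dx; apply: cvg_nnsfun_approx.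
have ndh x : D x -> {homo (fun n => (h n x)%:E) : m n / (m <= n)%N >-> m <= n}.
  by move=> Dx m n mn; rewrite lee_fin; exact/lefP/nd_nnsfun_approx.
transitivity (limn (fun n => \int[nu]_(x in D) (h n x)%:E)).
  rewrite -monotone_convergence//.
  - by apply: eq_integral => x /[!inE] Dx; apply/esym/cvg_lim => //; exact: hf.
  - by move=> n; exact/measurable_EFinP/measurable_funTS.
  - by move=> n x _; rewrite lee_fin.
under eq_fun do rewrite integral_density_nnsfun.
rewrite -monotone_convergence//.
- apply: eq_integral => x /[!inE] Dx; apply/cvg_lim => //.
  under eq_fun do rewrite EFinM.
  by apply: cvgeZr => //; exact: hf.
- move=> n; apply/measurable_EFinP/measurable_funM => //.
  exact: measurable_funTS.
- by move=> n x Dx; rewrite lee_fin mulr_ge0 ?g0.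
- move=> x Dx m n mn; rewrite lee_fin ler_wpM2r ?g0//.
  by have := ndh x Dx m n mn; rewrite lee_fin.
Qed.

End density.

(** * Inverse subordinators *)

Section exponential_law.
Context {R : realType}.
Local Notation leb := (@lebesgue_measure R).

Definition expo (c : R) (c0 : 0 < c) : probability (measurableTypeR R) R :=
  exponential_distribution_exponential_prob__canonical__probability_measure_Probability c0.

Lemma expo_integral (c : R) (c0 : 0 < c) (f : R -> \bar R) :
  measurable_fun (`]0, +oo[ : set R) f -> (forall x, 0 < x -> (0 <= f x)%E) ->
  (\int[expo c0]_(x in `]0%R, +oo[) f x =
   \int[leb]_(x in `]0%R, +oo[) (f x * (c * expR (- (c * x)))%:E))%E.
Proof.
move=> mf f0; rewrite (@integral_density _ _ _ leb _ _ (exponential_pdf c))//.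
- apply: eq_integral => x; rewrite inE/= in_itv/= andbT => x0.
  by rewrite exponential_pdfE ?ltW// mulNr.
- by apply: measurable_funTS; exact: measurable_exponential_pdf.
- by move=> x _; apply: exponential_pdf_ge0; exact: ltW.
- by move=> x; rewrite /= in_itv/= andbT; exact: f0.
Qed.

Lemma expo_itvNy0 (c : R) (c0 : 0 < c) : expo c0 `]-oo, 0%R]%classic = 0%E.
Proof.
rewrite /= /exponential_prob.
rewrite -integral_itv_bndo_bndc; last first.
  apply/measurable_EFinP; apply: measurable_funTS.
  exact: measurable_exponential_pdf.
rewrite integral0_eq// => x; rewrite /= in_itv/= => x0.
by rewrite lt0_exponential_pdf.
Qed.

Lemma expo_itvy (c : R) (c0 : 0 < c) (a : R) : 0 <= a ->
  expo c0 `]a, +oo[%classic = (expR (- (c * a)))%:E.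
Proof.
move=> a0; rewrite /= /exponential_prob.
have mf : measurable_fun (`]a, +oo[ : set R) (EFin \o exponential_pdf c).
  apply/measurable_EFinP; apply: measurable_funTS.
  exact: measurable_exponential_pdf.
rewrite integral_itv_obnd_cbnd//.
have cF : continuous (fun x : R => - expR (- c * x)).
  move=> x; apply: cvgN; apply: (cvg_comp ( *%R (- c)) expR).
    exact: mulrl_continuous.
  exact: continuous_expR.
rewrite (@ge0_continuous_FTC2y _ _ (fun x => - expR (- c * x)) _ 0)//.
- by rewrite EFinN oppeK add0e mulNr.
- by move=> x _; apply: exponential_pdf_ge0; exact: ltW.
- apply: (@continuous_subspaceW R^o _ _ [set` `[0, +oo[%R]).
    by move=> x /=; rewrite !in_itv/= !andbT; exact: le_trans.
  exact: within_continuous_exponential_pdf.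
- rewrite -oppr0; apply: cvgN.
  under eq_cvg do rewrite mulNr.
  apply: (@cvg_comp _ _ _ ( *%R c) (fun z => expR (- z)) _ (pinfty_nbhs R)).
    exact: gt0_cvgMry.
  exact: cvgr_expR.
- by apply: cvg_at_right_filter; exact: cF.
- move=> x; rewrite in_itv/= andbT => ax.
  by apply: derive1_exponential_pdf; rewrite in_itv/= andbT (le_lt_trans a0).
Qed.

Lemma expo_integral_pos (c : R) (c0 : 0 < c) (f : R -> \bar R) :
  measurable_fun setT f -> (forall x, 0 <= f x)%E ->
  (\int[expo c0]_x f x = \int[expo c0]_(x in `]0%R, +oo[) f x)%E.
Proof.
move=> mf f0.
rewrite (@ge0_negligible_integral _ _ _ _ setT
  (`]-oo, 0%R]%classic : set (measurableTypeR R)))//.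
- by rewrite setTD setCitvl.
- exact: expo_itvNy0.
Qed.

End exponential_law.

Section passage_time.
Context d (Omega : measurableType d) (R : realType) (P : probability Omega R).
Variable S : R -> {RV P >-> R}.
Hypothesis S0 : forall w, S 0 w = 0.
Hypothesis S_nd : forall (s t : R) w, 0 <= s -> s <= t -> S s w <= S t w.

Local Notation E := (inverse_subordinator S).

Lemma inverse_subordinator_ge0 t w : (0 <= E t w)%E.
Proof. by apply/ereal_infP => _ [s [s0 _] <-]; rewrite lee_fin. Qed.

(** Paths are nondecreasing, so a time at which level [t] is reached can be raised to a rational one
    still below [x]. The event is thus a countable union, which yields measurability jointly in [t]
    and [w]. *)
Lemma inverse_subordinator_lt t w (x : \bar R) : (E t w < x)%E <->
  exists q : rat, [/\ 0 <= ratr q :> R, ((ratr q : R)%:E < x)%E & t <= S (ratr q) w].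
Proof.
split => [/ereal_inf_lt[_ [s [s0 tS] <-] sx]|[q [q0 qx tS]]]; last first.
  by apply: le_lt_trans qx; apply: ereal_inf_lbound; exists (ratr q).
have [y sy yx] : exists2 y : R, s < y & (y%:E <= x)%E.
  move: x sx => [r|_|//]; first by rewrite lte_fin => sr; exists r.
  by exists (s + 1); rewrite ?ltrDl// leey.
have [q] := rat_in_itvoo sy; rewrite in_itv/= => /andP[sq qy].
exists q; split; first by rewrite ltW// (le_lt_trans s0).
  by rewrite (lt_le_trans _ yx).
by rewrite (le_trans tS)// S_nd// ltW.
Qed.

Lemma measurable_inverse_subordinator : measurable_fun setT
  (fun z : measurableTypeR R * Omega => E z.1 z.2).
Proof.
apply: (measurability _ (ErealGenInftyO.measurableE R)) => _ /= -[_ [r ->] <-].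
rewrite setTI preimage_itvNyo.
rewrite (_ : [set _ | _] = \bigcup_(q : rat)
    (if (0 <= ratr q :> R) && (ratr q < r) then
       [set z : measurableTypeR R * Omega | z.1 <= S (ratr q) z.2]
     else set0)); last first.
  apply/seteqP; split => [z /= /inverse_subordinator_lt[q [q0 qr tS]]|].
    by exists q => //; rewrite q0 -lte_fin qr.
  move=> z [q _]; case: ifPn => // /andP[q0 qr] tS.
  by apply/inverse_subordinator_lt; exists q; split.
apply: bigcupT_measurable_rat => q; case: ifPn => // _.
rewrite -[X in measurable X]setTI; 
apply: (@measurable_fun_le _ _ R setT
  (fun z : measurableTypeR R * Omega => z.1 : R) (fun z => S (ratr q) z.2)) => //.
  exact: (@measurable_fst _ _ (measurableTypeR R) Omega).
by apply: measurableT_comp => //; exact: measurable_snd.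
Qed.

Lemma inverse_subordinator_gt a t w : 0 <= a -> (a%:E < E t w)%E -> S a w < t.
Proof.
move=> a0; apply: contraTT; rewrite -!leNgt => tS.
by apply: ereal_inf_lbound; exists a.
Qed.

Lemma inverse_subordinator_ge a t w : S a w < t -> (a%:E <= E t w)%E.
Proof.
move=> Sat; apply/ereal_infP => _ [s [s0 tS] <-]; rewrite lee_fin leNgt.
apply/negP => sa; have := S_nd w s0 (ltW sa).
by rewrite leNgt => /negP; apply; exact: lt_le_trans tS.
Qed.

Variable G : R -> R -> R.
Hypothesis hG : inverse_density S G.

Let mEt t : measurable_fun setT (E t).
Proof.
exact: measurable_fun_pair2 measurable_inverse_subordinator.
Qed.

(* The events differ by a part of [{E t = a}], which is null since the law of
   [E t] has a density. *)
Lemma inverse_subordinator_tail a t : 0 <= a -> 0 < t ->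
  P [set w | (a%:E < E t w)%E] = P [set w | S a w < t].
Proof.
move=> a0 t0.
have mgt : measurable [set w | (a%:E < E t w)%E].
  by rewrite -[X in measurable X]setTI; exact: emeasurable_fun_o_infty.
have mS : measurable [set w | S a w < t].
  rewrite (_ : mkset _ = S a @^-1` `]-oo, t[); first exact: measurable_funPTI.
  by apply/seteqP; split => w /=; rewrite in_itv.
have mEa : measurable (E t @^-1` (EFin @` [set a])).
  by rewrite image_set1 -[X in measurable X]setTI; exact: mEt.
have Ea0 : P (E t @^-1` (EFin @` [set a])) = 0%E.
  have [_ _ ->//] := hG t0.
  by apply: integral_Sset1; exact: subIsetr.
apply/eqP; rewrite eq_le; apply/andP; split.
  by apply: le_measure; rewrite ?inE//= => w; exact: inverse_subordinator_gt.
rewrite -[leRHS]adde0 -Ea0; apply: le_trans (measureU2 _ _ _) => //.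
apply: le_measure; rewrite ?inE//=; first exact: measurableU.
move=> w /inverse_subordinator_ge; rewrite le_eqVlt => /predU1P[aE|]; last by left.
by right; exists a.
Qed.

End passage_time.

(** * Sampling at an exponential time *)

Section law_at_exponential_time.
Context d (Omega : measurableType d) (R : realType) (P : probability Omega R).
Variables (S : R -> {RV P >-> R}) (G : R -> R -> R).
Hypothesis S0 : forall w, S 0 w = 0.
Hypothesis S_nd : forall (s t : R) w, 0 <= s -> s <= t -> S s w <= S t w.
Hypothesis hG : inverse_density S G.
Variables (l p : R) (l0 : 0 < l) (p0 : 0 < p).
Hypothesis S_laplace : forall a, 0 <= a ->
  ('E_P[fun w => expR (- (l * S a w))])%E = (expR (- (a * p)))%:E.

Local Notation leb := (@lebesgue_measure R).
Local Notation E := (inverse_subordinator S).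
Local Notation Q := (expo l0 \x P)%E.
Local Notation mE := (measurable_inverse_subordinator S_nd).

Let tail_set a := [set z : measurableTypeR R * Omega | (a%:E < E z.1 z.2)%E].
Let jump_set a := [set z : measurableTypeR R * Omega | S a z.2 < z.1].

Let measurable_tail a : measurable (tail_set a).
Proof.
by rewrite -[X in measurable X]setTI; apply: emeasurable_fun_o_infty => //; exact: mE.
Qed.

Let measurable_jump a : measurable (jump_set a).
Proof.
rewrite (_ : jump_set a = ~` [set z : measurableTypeR R * Omega | z.1 <= S a z.2]).
  apply: measurableC; rewrite -[X in measurable X]setTI.
  apply: (@measurable_fun_le _ _ R setT
    (fun z : measurableTypeR R * Omega => z.1 : R) (fun z => S a z.2)) => //.
    exact: (@measurable_fst _ _ (measurableTypeR R) Omega).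
  by apply: measurableT_comp => //; exact: measurable_snd.
by apply/seteqP; split => z /=; [move/lt_geF/negbT/negP|move/negP; rewrite -ltNge].
Qed.

Let Q_xsection A : measurable A ->
  Q A = (\int[expo l0]_(s in `]0%R, +oo[) P (xsection A s))%E.
Proof.
move=> mA; rewrite /product_measure1/=.
rewrite expo_integral_pos//.
exact: measurable_fun_xsection.
Qed.

(** For a fixed path, the exponential time exceeds [S a w >= 0] with probability [exp(- l * S a w)];
    the mean of this over paths is the Laplace transform of [S a] at [l]. *)
Let Q_tail a : 0 <= a -> Q (tail_set a) = (expR (- (p * a)))%:E.
Proof.
move=> a0; transitivity (Q (jump_set a)).
  rewrite !Q_xsection//; apply: eq_integral => s; rewrite inE/= in_itv/= andbT => s0.
  have := inverse_subordinator_tail S_nd hG a0 s0.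
  congr (_ = _); congr (P _); apply/seteqP; split => w /=;
    rewrite /xsection/= ?inE//.
transitivity (\int[Q]_z (\1_(jump_set a) z)%:E)%E; first by rewrite integral_indic// setIT.
rewrite fubini_tonelli2//; last first.
  by apply/measurable_EFinP.
rewrite mulrC -S_laplace// unlock /fubini_G; apply: eq_integral => w _.
rewrite -expo_itvy//; last first.
  by rewrite -(S0 w) S_nd.
rewrite -(setIT `]S a w, +oo[%classic) -integral_indic//.
apply: eq_integral => s _; rewrite !indicE; congr ((_ : bool)%:R%:E).
by apply/idP/idP; rewrite !inE /= in_itv/= andbT.
Qed.

(** [fine] sends [+oo] to 0. Under [Q] this alters only a null event, by [Q_infinite]. *)
Let T (z : measurableTypeR R * Omega) : measurableTypeR R := fine (E z.1 z.2).

Let mT : measurable_fun setT T.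
Proof. exact: measurableT_comp mE. Qed.

Let infinite_set := [set z : measurableTypeR R * Omega | E z.1 z.2 = +oo%E].

Let measurable_infinite : measurable infinite_set.
Proof.
by rewrite -[X in measurable X]setTI; exact: (mE measurableT (emeasurable_set1 +oo%E)).
Qed.

Let Q_infinite : Q infinite_set = 0%E.
Proof.
apply/eqP; rewrite eq_le measure_ge0 andbT; apply/lee_addgt0Pr => e e0.
(* An infinite passage time exceeds every [a]; this one makes the tail [exp(- p * a)] at most [e],
   and the maximum with 0 gives the sign required by [Q_tail]. *)
rewrite add0e; pose a := Num.max 0 (- ln e / p).
have a0 : 0 <= a by rewrite le_max lexx.
apply: (@le_trans _ _ (Q (tail_set a))).
  apply: le_measure; rewrite ?inE// => z.
  by rewrite /infinite_set /tail_set /= => ->; exact: ltry.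
rewrite Q_tail// lee_fin -[leRHS](lnK e0) ler_expR lerNl mulrC -ler_pdivrMr//.
by rewrite le_max lexx orbT.
Qed.

Let T_law_itvy x : Q (T @^-1` `]x, +oo[) = expo p0 `]x, +oo[%classic.
Proof.
have mTx y : measurable (T @^-1` `]y, +oo[).
  by rewrite -[X in measurable X]setTI; exact: mT.
have E0 z : (0 <= E z.1 z.2)%E by exact: inverse_subordinator_ge0.
have [x0|x0] := leP 0 x.
  rewrite expo_itvy// -Q_tail//; apply/eqP; rewrite eq_le; apply/andP; split.
    apply: le_measure; rewrite ?inE// => z; rewrite /T /tail_set /= in_itv/= andbT.
    by move: (E0 z); case: (E z.1 z.2) => //= r _; exact: ltry.
  rewrite -[leRHS]adde0 -[X in (_ + X)%E]Q_infinite.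
  apply: le_trans (measureU2 _ _ _) => //.
  apply: le_measure; rewrite ?inE//; first exact: measurableU.
  move=> z; rewrite /T /= in_itv/= andbT /infinite_set /tail_set/=.
  by case: (E z.1 z.2) => //= [r|_]; [rewrite lte_fin; left|right].
rewrite (_ : T @^-1` _ = setT); last first.
  rewrite -subTset => z _; rewrite /= in_itv/= andbT (lt_le_trans x0)//.
  by rewrite fine_ge0.
have -> : Q setT = 1%E by exact: probability_setT.
apply/eqP; rewrite eq_le probability_le1// andbT.
rewrite (_ : 1%E = expo p0 `]0, +oo[%classic).
  apply: le_measure; rewrite ?inE//= => y; rewrite /= !in_itv/= !andbT.
  exact: lt_trans.
by rewrite expo_itvy// mulr0 oppr0 expR0.
Qed.

Let T_law B : measurable B -> pushforward Q T B = expo p0 B.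
Proof.
move=> mB.
pose m1 : {measure set (measurableTypeR R) -> \bar R} :=
  measure_function_pushforward__canonical__measure_function_Measure Q mT.
apply: (@measure_unique _ R (measurableTypeR R) (@RGenOInfty.G R)
  (fun n => `](- n%:R)%R, +oo[%classic) _ _ _ _ m1 (expo p0) _ _ B) => //.
- exact: RGenOInfty.measurableE.
- move=> _ _ [x ->] [y ->]; exists (Num.max x y).
  by apply/seteqP; split => z /=; rewrite !in_itv/= !andbT gt_max; [case=> -> ->|move=> /andP].
- by move=> n; exists (- n%:R).
- rewrite -subTset => x _; exists (Num.Def.archi_bound `|x|) => //=.
  rewrite in_itv/= andbT ltrNl.
  apply: (le_lt_trans (ler_norm (- x))); rewrite normrN.
  exact: archi_boundP.
- by move=> _ [x ->]; exact: T_law_itvy.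
- move=> n; rewrite (_ : m1 _ = expo p0 `](- n%:R)%R, +oo[%classic).
    by rewrite (le_lt_trans (probability_le1 _ _))// ltry.
  exact: T_law_itvy.
Qed.

Section subordination.
Variable v : R -> R.
Hypothesis mv : measurable_fun (`]0, +oo[ : set R) v.
Hypothesis v0 : forall y, 0 < y -> 0 <= v y.

Local Notation vE s := (\int[leb]_(tau in `]0%R, +oo[) (v tau * G s tau)%:E)%E.

(** Extension of [v] by 0: the value 0, where [T] places the infinite passage times, contributes
    nothing. *)
Let vp : measurableTypeR R -> \bar R := (EFin \o v) \_ `]0, +oo[.

Let mvp : measurable_fun setT vp.
Proof.
apply/(measurable_restrictT (EFin \o v) (measurable_itv `]0, +oo[)).
exact/measurable_EFinP.
Qed.

Let mvpT : measurable_fun setT (vp \o T).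
Proof. exact: (measurableT_comp mvp mT). Qed.

Let vp0 y : (0 <= vp y)%E.
Proof.
by apply: erestrict_ge0 => {}y; rewrite /= in_itv/= andbT lee_fin; exact: v0.
Qed.

Let vpE s : 0 < s -> (\int[P]_w vp (T (s, w)) = vE s)%E.
Proof.
move=> s0.
have mTs : measurable_fun setT (fun w => T (s, w)).
  exact: measurable_fun_pair2 mT.
transitivity (\int[pushforward P (fun w => T (s, w))]_y vp y)%E.
  by rewrite ge0_integral_pushforward.
rewrite /vp -integral_mkcond.
have [mG G0 hB] := hG s0.
rewrite (@integral_density _ _ _ leb _ _ (G s))//.
- by move=> x; rewrite /= in_itv/= andbT; exact: G0.
- move=> B mB BD; rewrite -[in RHS](setIidr BD) -hB//.
  congr (P _); apply/seteqP; split => w /=.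
    (* [B] lies in the open half-line, which excludes the default value 0 of [fine] and so forces
       [E s w] to be finite. *)
    move=> Bw; exists (T (s, w)) => //; rewrite /T fineK//.
    have := BD _ Bw; rewrite /T /= in_itv/= andbT.
    by case: (E s w) => //=; rewrite ltxx.
  by move=> [r Br rE]; rewrite /T /= -rE.
- exact/measurable_EFinP.
- by move=> x; rewrite /= in_itv/= andbT lee_fin; exact: v0.
Qed.

Lemma measurable_subordinated :
  measurable_fun (`]0, +oo[ : set R) (fun s => vE s).
Proof.
have mF : measurable_fun setT (fubini_F P (vp \o T)).
  by apply: measurable_fun_fubini_tonelli_F => // z; exact: vp0.
have mF0 : measurable_fun (`]0, +oo[ : set R) (fubini_F P (vp \o T)).
  exact: measurable_funTS mF.
move: mF0; apply: eq_measurable_fun => s; rewrite inE/= in_itv/= andbT => s0.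
by rewrite /fubini_F vpE.
Qed.

(** Both sides are the mean of [v] at the passage time of an exponential level. Averaging over paths
    first gives [vE s] weighted by the exponential law of rate [l]; using the law of [T] gives the
    exponential law of rate [p]. *)
Lemma laplace_subordinated :
  (\int[leb]_(s in `]0%R, +oo[) (vE s * (l * expR (- (l * s)))%:E) =
   \int[leb]_(y in `]0%R, +oo[) (v y * (p * expR (- (p * y))))%:E)%E.
Proof.
transitivity (\int[Q]_z vp (T z))%E.
  rewrite (fubini_tonelli1 _ mvpT (fun z => vp0 (T z))).
  rewrite expo_integral_pos.
  - rewrite -expo_integral; last 2 first.
    + exact: measurable_subordinated.
    + move=> s s0; rewrite -vpE//; exact: integral_ge0.
    apply: eq_integral => s; rewrite inE/= in_itv/= andbT => s0.
    by rewrite /fubini_F vpE.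
  - by apply: measurable_fun_fubini_tonelli_F => // z; exact: vp0.
  - by move=> s; apply: integral_ge0 => w _; exact: vp0.
transitivity (\int[pushforward Q T]_y vp y)%E.
  by rewrite ge0_integral_pushforward.
transitivity (\int[expo p0]_y vp y)%E.
  by apply: eq_measure_integral => B mB _; exact: T_law.
rewrite /vp -integral_mkcond expo_integral//; exact/measurable_EFinP.
Qed.

End subordination.
End law_at_exponential_time.

(** * The Laplace exponent and the kernel *)

Section levy_kernel.
Context {R : realType}.
Local Notation leb := (@lebesgue_measure R).

Lemma expo_itv0 (c : R) (c0 : 0 < c) (t : R) : 0 < t ->
  expo c0 `]0, t[%classic = (1 - expR (- (c * t)))%:E.
Proof.
move=> t0; have mf (A : set R) : measurable_fun A (EFin \o exponential_pdf c).
  apply/measurable_EFinP; apply: measurable_funTS.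
  exact: measurable_exponential_pdf.
have -> : expo c0 `]0, t[%classic = expo c0 `]0, t]%classic.
  by rewrite /= /exponential_prob integral_itv_bndo_bndc.
have E : (expo c0 `]0%R, +oo[%classic =
    expo c0 `]0%R, t]%classic + expo c0 `]t, +oo[%classic)%E.
  rewrite -measureU//; last first.
    apply/seteqP; split => x //=; rewrite !in_itv/= andbT => -[/andP[_ xt]].
    by rewrite ltNge xt.
  by congr (expo c0 _); rewrite -itv_bndbnd_setU// bnd_simp ltW.
move: E; rewrite (expo_itvy c0 (lexx 0)) (expo_itvy c0 (ltW t0)) mulr0 oppr0 expR0 EFinB => ->.
by rewrite addeK.
Qed.

Variables (sigma : {measure set R -> \bar R}) (k : R -> R).
Hypothesis hk : associated_kernel sigma k.

Let mpos : measurable (`]0%R, +oo[%classic : set R).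
Proof. exact: measurable_itv. Qed.

Let ms : {measure set R -> \bar R} := mrestr sigma mpos.

(** [sigma] may be infinite near 0, but its tails are values of the real function [k], hence finite,
    and [ms] vanishes on the non-positive half-line. Tonelli's theorem needs this. *)
Let ms_sigma_finite : sigma_finite setT ms.
Proof.
exists (fun n => `]-oo, 0] `|` `](n.+1%:R^-1)%R, +oo[).
  apply/esym; rewrite -subTset => x _.
  have [x0|x0] := leP x 0; first by exists 0%N => //; left.
  exists (Num.Def.archi_bound x^-1) => //; right.
  rewrite /= in_itv/= andbT invf_plt ?posrE//.
  rewrite (@lt_trans _ _ (Num.Def.archi_bound x^-1)%:R) ?ltr_nat//.
  by apply: archi_boundP; rewrite invr_ge0 ltW.
move=> n; split; first exact: measurableU.
rewrite /ms/= /mrestr (_ : _ `&` _ = `](n.+1%:R^-1)%R, +oo[%classic).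
  by rewrite -hk ?ltry// invr_gt0.
apply/seteqP; split => x /=; rewrite !in_itv/= !andbT.
  by move=> -[[x0|//] /lt_geF]; rewrite x0.
move=> nx; split; first by right.
by apply: lt_trans nx; rewrite invr_gt0.
Qed.

Let msf : {sigma_finite_measure set R -> \bar R} :=
  HB.pack_for (SigmaFiniteMeasure.type _ R) (Measure.sort ms)
   (Measure_isSigmaFinite.Build _ _ _ ms ms_sigma_finite).

Variables (l : R) (l0 : 0 < l).

Let A := [set z : measurableTypeR R * R | 0 < z.1 /\ z.1 < z.2].

Let measurable_A : measurable A.
Proof.
rewrite (_ : A = (fst @^-1` `]0%R, +oo[%classic) `&`
    ~` [set z : measurableTypeR R * R | z.2 <= z.1]).
  apply: measurableI.
    rewrite -[X in measurable X]setTI.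
    by apply: (@measurable_fst _ _ (measurableTypeR R) R).
  apply: measurableC; rewrite -[X in measurable X]setTI.
  apply: (@measurable_fun_le _ _ R setT
    (fun z : measurableTypeR R * R => z.2 : R) (fun z => z.1 : R)) => //.
    exact: (@measurable_snd _ _ (measurableTypeR R) R).
  exact: (@measurable_fst _ _ (measurableTypeR R) R).
by apply/seteqP; split => z /=; rewrite in_itv/= andbT => -[z0 z12];
  split => //; move: z12; rewrite ltNge => /negP.
Qed.

Let xsectionA t : 0 < t -> ms (xsection A t) = (k t)%:E.
Proof.
move=> t0; rewrite hk// /ms/= /mrestr; congr (sigma _).
apply/seteqP; split => x /=; rewrite /xsection/= inE /A/= !in_itv/= !andbT.
  by move=> -[[]].
by move=> tx; do !split => //; exact: lt_trans tx.
Qed.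

Let ysectionA x : 0 < x -> expo l0 (ysection A x) = (1 - expR (- (l * x)))%:E.
Proof.
move=> x0; rewrite -expo_itv0//; congr (expo l0 _).
by apply/seteqP; split => t /=; rewrite /ysection/= inE /A/= in_itv/= => /andP.
Qed.

Let mF : measurable_fun setT (msf \o xsection A).
Proof. exact: measurable_fun_xsection. Qed.

Lemma measurable_associated_kernel : measurable_fun (`]0, +oo[ : set R) k.
Proof.
apply/measurable_EFinP.
have mF0 : measurable_fun (`]0, +oo[ : set R) (msf \o xsection A).
  exact: measurable_funTS mF.
move: mF0; apply: eq_measurable_fun => t; rewrite inE/= in_itv/= andbT => t0.
exact: xsectionA.
Qed.

(** Both sides measure the region [0 < t < x] under the product of an exponential law in [t] and
    [sigma] in [x]: the section at [t] has mass [k t], the section at [x] has mass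
    [1 - exp(- l * x)]. *)
Lemma laplace_exponent_kernel :
  (\int[sigma]_(x in `]0%R, +oo[) (1 - expR (- (l * x)))%:E =
   \int[leb]_(t in `]0%R, +oo[) (k t * (l * expR (- (l * t))))%:E)%E.
Proof.
have k0 t : 0 < t -> 0 <= k t by move=> t0; rewrite -lee_fin hk.
transitivity (\int[expo l0]_(t in `]0%R, +oo[) (k t)%:E)%E; last first.
  rewrite expo_integral//.
  by apply/measurable_EFinP; exact: measurable_associated_kernel.
transitivity ((expo l0 \x msf) A)%E; last first.
  rewrite /product_measure1/= (expo_integral_pos l0 mF)//.
  by apply: eq_integral => t; rewrite inE/= in_itv/= andbT => t0; exact: xsectionA.
transitivity (\int[msf]_x (\int[expo l0]_t (\1_A (t, x))%:E))%E; last first.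
  have m1A : measurable_fun setT (EFin \o (\1_A : measurableTypeR R * R -> R)).
    exact/measurable_EFinP.
  have := fubini_tonelli2 (m1 := expo l0) (m2 := msf) _ m1A.
  rewrite /fubini_G /= => <-; last by move=> z; rewrite lee_fin.
  have := @integral_indic _ _ _ (expo l0 \x msf)%E setT measurableT A measurable_A.
  by rewrite setIT => ->.
transitivity (\int[msf]_(x in `]0%R, +oo[) (1 - expR (- (l * x)))%:E)%E.
  apply: eq_measure_integral => B mB BD.
  by rewrite /= /mrestr setIidl.
rewrite integral_mkcond; apply: eq_integral => x _; rewrite patchE.
transitivity (expo l0 (ysection A x)); last first.
  rewrite -[X in expo l0 X]setIT -integral_indic//.
    by apply: eq_integral => t _; rewrite !indicE /ysection/= mem_setE.
  exact: measurable_ysection.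
case: ifPn => [/set_mem|]; rewrite ?notin_setE/= in_itv/= andbT => x0.
  by rewrite ysectionA.
rewrite (_ : ysection A x = set0) ?measure0//; apply/seteqP; split => // t.
rewrite /ysection/= inE /A/= => -[t0 tx]; apply: x0.
exact: lt_trans tx.
Qed.

Hypothesis K0 : 0 < laplace_transform k l.

Lemma laplace_exponentE : laplace_exponent sigma l = l * laplace_transform k l.
Proof.
have k0 t : 0 < t -> 0 <= k t by move=> t0; rewrite -lee_fin hk.
rewrite /laplace_exponent /Rintegral laplace_exponent_kernel.
have mk := measurable_associated_kernel.
have mek : measurable_fun (`]0, +oo[ : set R) (fun t => expR (- (l * t)) * k t).
  apply: measurable_funM => //; apply: measurable_funTS.
  exact: measurable_decay.
rewrite -[l in RHS]/(fine l%:E) -fineM//.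
  rewrite -ge0_integralZl_EFin ?ltW//.
  - congr fine; apply: eq_integral => t _.
    by rewrite -EFinM mulrCA [k t * _]mulrC.
  - move=> t; rewrite /= in_itv/= andbT => t0.
    by rewrite lee_fin mulr_ge0 ?expR_ge0 ?k0.
  - exact/measurable_EFinP.
(* The real-valued integral is 0 when the extended one is [+oo], so its positivity forces
   finiteness. *)
move: K0; rewrite /laplace_transform /Rintegral.
rewrite ge0_fin_numE; last first.
  apply: integral_ge0 => t; rewrite /= in_itv/= andbT => t0.
  by rewrite lee_fin mulr_ge0 ?expR_ge0 ?k0.
by case: (integral _ _ _) => [r||] //=; rewrite ?ltxx// ltry.
Qed.

End levy_kernel.

(** * Laplace transforms of primitives *)

Section primitive.
Context {R : realType}.
Local Notation leb := (@lebesgue_measure R).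
Variable f : R -> \bar R.
Hypothesis mf : measurable_fun (`]0, +oo[ : set R) f.
Hypothesis f0 : forall s, 0 < s -> (0 <= f s)%E.
Hypothesis f_laplace : forall l, 0 < l ->
  (\int[leb]_(s in `]0%R, +oo[) (f s * (expR (- (l * s)))%:E) < +oo)%E.

Definition primitive (g : R -> \bar R) (t : R) : R :=
  fine (\int[leb]_(s in `]0%R, t]) g s)%E.

Let mdecay (D : set R) l : measurable_fun D (fun s => (expR (- (l * s)))%:E).
Proof. by apply/measurable_EFinP; apply: measurable_funTS; exact: measurable_decay. Qed.

Let fe0 l s : 0 < s -> (0 <= f s * (expR (- (l * s)))%:E)%E.
Proof. by move=> s0; rewrite mule_ge0 ?f0// lee_fin expR_ge0. Qed.

Let sub0 t : (`]0, t] : set R) `<=` `]0, +oo[.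
Proof. by move=> x; rewrite /= !in_itv/= andbT => /andP[]. Qed.

(** On the interval, [1 <= exp(t) * exp(- s)], so the integral is at most [exp(t)] times the Laplace
    transform of [f] at 1. *)
Let integral_fin t : (\int[leb]_(s in `]0%R, t]) f s)%E \is a fin_num.
Proof.
rewrite ge0_fin_numE; last first.
  by apply: integral_ge0 => s; rewrite /= in_itv/= => /andP[s0 _]; exact: f0.
have mf1 : measurable_fun (`]0, +oo[ : set R) (fun s => f s * (expR (- (1 * s)))%:E)%E.
  exact: emeasurable_funM.
apply: (@le_lt_trans _ _
    ((expR t)%:E * \int[leb]_(s in `]0%R, +oo[) (f s * (expR (- (1 * s)))%:E))%E);
  last first.
  by rewrite lte_mul_pinfty ?lee_fin ?expR_ge0//; exact: f_laplace.
rewrite -ge0_integralZl_EFin ?expR_ge0//; last first.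
  by move=> s; rewrite /= in_itv/= andbT; exact: fe0.
have mf2 : measurable_fun (`]0, +oo[ : set R)
    (fun s => (expR t)%:E * (f s * (expR (- (1 * s)))%:E))%E.
  by apply: emeasurable_funM => //; exact: measurable_cst.
apply: (@le_trans _ _
    (\int[leb]_(s in `]0%R, t]) ((expR t)%:E * (f s * (expR (- (1 * s)))%:E)))%E).
  apply: ge0_le_integral => //.
  - by move=> s; rewrite /= in_itv/= => /andP[s0 _]; exact: f0.
  - exact: measurable_funS mf.
  - exact: measurable_funS mf2.
  - move=> s; rewrite /= in_itv/= => /andP[s0 st].
    rewrite muleCA -EFinM -expRD mul1r; apply: lee_pemulr; first exact: f0.
    by rewrite lee_fin -expR0 ler_expR subr_ge0.
apply: ge0_subset_integral => //.
move=> s; rewrite /= in_itv/= andbT => s0.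
by rewrite mule_ge0 ?fe0// lee_fin expR_ge0.
Qed.

Lemma EFin_primitive t :
  (primitive f t)%:E = (\int[leb]_(s in `]0%R, t]) f s)%E.
Proof. by rewrite /primitive fineK. Qed.

Lemma primitive_ge0 t : 0 <= primitive f t.
Proof.
apply: fine_ge0; apply: integral_ge0 => s.
by rewrite /= in_itv/= => /andP[s0 _]; exact: f0.
Qed.

Lemma primitive_nondecreasing : nondecreasing_fun (primitive f).
Proof.
move=> s t st; rewrite -lee_fin !EFin_primitive.
apply: ge0_subset_integral => //.
- exact: measurable_funS mf.
- by move=> x; rewrite /= in_itv/= => /andP[x0 _]; exact: f0.
- by move=> x; rewrite /= !in_itv/= => /andP[-> /le_trans]; apply.
Qed.

Section laplace.
Variables (l : R) (l0 : 0 < l).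

Let A := [set z : measurableTypeR R * measurableTypeR R | (z.1 : R) <= z.2].

Let mA : measurable A.
Proof.
rewrite -[X in measurable X]setTI.
apply: (@measurable_fun_le _ _ R setT
  (fun z : measurableTypeR R * measurableTypeR R => z.1 : R) (fun z => z.2 : R)) => //.
  exact: (@measurable_fst _ _ (measurableTypeR R) (measurableTypeR R)).
exact: (@measurable_snd _ _ (measurableTypeR R) (measurableTypeR R)).
Qed.

Let fp : measurableTypeR R -> \bar R := f \_ `]0, +oo[.

Let mfp : measurable_fun setT fp.
Proof. exact/(measurable_restrictT f (measurable_itv `]0, +oo[)). Qed.

Let fp0 s : (0 <= fp s)%E.
Proof.
by apply: erestrict_ge0 => {}s; rewrite /= in_itv/= andbT; exact: f0.
Qed.

Let F (z : measurableTypeR R * measurableTypeR R) : \bar R :=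
  (fp z.1 * (\1_A z)%:E)%E.

Let mF : measurable_fun setT F.
Proof.
apply: emeasurable_funM; last exact/measurable_EFinP.
by apply: (measurableT_comp mfp); exact: measurable_fst.
Qed.

Let F0 z : (0 <= F z)%E.
Proof. by rewrite mule_ge0// lee_fin. Qed.

Let expo_itvcy s : 0 <= s -> expo l0 `[s, +oo[%classic = (expR (- (l * s)))%:E.
Proof.
move=> s0; rewrite -(expo_itvy l0 s0) /= /exponential_prob integral_itv_obnd_cbnd//.
apply/measurable_EFinP; apply: measurable_funTS.
exact: measurable_exponential_pdf.
Qed.

(** Integration by parts in the form of Tonelli's theorem on [s <= t], with [t] exponential of rate
    [l]: integrating in [s] first gives [primitive f t], integrating in [t] first gives the
    probability [exp(- l * s)] that [t] is at least [s]. *)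
Lemma laplace_primitive :
  (\int[leb]_(t in `]0%R, +oo[) (primitive f t * (l * expR (- (l * t))))%:E =
   \int[leb]_(s in `]0%R, +oo[) (f s * (expR (- (l * s)))%:E))%E.
Proof.
have mU : measurable_fun (`]0, +oo[ : set R) (primitive f).
  by apply: nondecreasing_measurable => //; exact: primitive_nondecreasing.
transitivity (\int[expo l0]_(t in `]0%R, +oo[) (primitive f t)%:E)%E.
  rewrite expo_integral//; first exact/measurable_EFinP.
  by move=> t _; rewrite lee_fin primitive_ge0.
have := fubini_tonelli (m1 := leb) (m2 := expo l0) F mF F0.
move=> H; transitivity (\int[expo l0]_t \int[leb]_s F (s, t))%E.
  have FE t : (\int[leb]_s F (s, t) = (primitive f t)%:E)%E.
    rewrite EFin_primitive [RHS]integral_mkcond; apply: eq_integral => s _.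
    rewrite /F /= /fp indicE !patchE.
    have -> : ((s, t) \in A) = (s <= t) by apply/idP/idP; rewrite inE.
    rewrite !mem_setE !in_itv/= andbT.
    by case: (0 < s); case: (s <= t); rewrite /= ?mule1 ?mule0 ?mul0e.
  rewrite [RHS]expo_integral_pos.
  - by apply: eq_integral => t _; rewrite FE.
  - by under eq_fun do rewrite FE; apply/measurable_EFinP;
      apply: nondecreasing_measurable => //; exact: primitive_nondecreasing.
  - by move=> t; apply: integral_ge0 => s _; exact: F0.
rewrite -H [RHS]integral_mkcond; apply: eq_integral => s _.
rewrite /F /= ge0_integralZl//; last first.
  have m1A : measurable_fun setT
      (EFin \o (\1_A : measurableTypeR R * measurableTypeR R -> R)).
    exact/measurable_EFinP.
  exact: (@measurable_fun_pair2 _ _ _ _ _ _ _ s m1A).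
rewrite patchE /fp patchE; case: ifPn => [|_]; last by rewrite mul0e.
rewrite inE/= in_itv/= andbT => s0; congr (_ * _)%E.
rewrite -expo_itvcy ?ltW// -[X in expo l0 X]setIT -integral_indic//.
apply: eq_integral => t _; rewrite !indicE; congr ((_ : bool)%:R%:E).
by apply/idP/idP; rewrite !inE /A /= in_itv/= andbT.
Qed.

End laplace.
End primitive.

(** * Abelian limit at 0 and regular variation of the kernel *)

Section abelian.
Context {R : realType}.
Local Notation leb := (@lebesgue_measure R).

(* [`|q|] makes the integral finite on both sides of [0]. *)
Lemma cvg_laplace0 (v : R -> R) :
  leb.-integrable `]0, +oo[ (EFin \o v) ->
  \int[leb]_(y in `]0, +oo[) (v y * expR (- (`|q| * y))) @[q --> (0 : R)] -->
  \int[leb]_(y in `]0, +oo[) v y.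
Proof.
move=> iv.
have mv : measurable_fun (`]0, +oo[ : set R) v.
  by apply/measurable_EFinP; exact: (measurable_int leb).
pose J (q : R) := \int[leb]_(y in `]0, +oo[) (v y * expR (- (`|q| * y))).
have -> : \int[leb]_(y in `]0, +oo[) v y = J 0.
  by apply: eq_Rintegral => y _; rewrite normr0 mul0r oppr0 expR0 mulr1.
have le_v (q y : R) : 0 < y -> `|v y * expR (- (`|q| * y))| <= `|v y|.
  move=> y0; rewrite normrM (ger0_norm (expR_ge0 _)) -[leRHS]mulr1.
  by rewrite ler_wpM2l// -expR0 ler_expR oppr_le0 mulr_ge0// ltW.
have m0 (q : R) : measurable_fun (`]0, +oo[ : set R) (fun y => v y * expR (- (`|q| * y))).
  by apply: measurable_funM => //; apply: measurable_funTS; exact: measurable_decay.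
apply: (@continuity_under_integral R _ _ leb
  (fun q y : R => v y * expR (- (`|q| * y))) `]0, +oo[ _ (- 1) 1 _ _
  (fun y => `|v y|)) => //.
- move=> q _; apply: le_integrable iv => //.
    by apply/measurable_EFinP; exact: m0.
  by move=> y; rewrite /= in_itv/= andbT lee_fin; exact: le_v.
- apply: aeW => y _ q _; apply: cvgM; first exact: cvg_cst.
  apply: (cvg_comp (fun q : R => - (`|q| * y)) expR); last exact: continuous_expR.
  apply: cvgN; apply: cvgM; last exact: cvg_cst.
  exact: norm_continuous.
- exact: integrable_norm.
- move=> q _; apply: aeW => y; rewrite /= in_itv/= andbT; exact: le_v.
- by apply/mem_set; rewrite /= in_itv/= ltr01 oppr_lt0 ltr01.
Qed.

(** Slow variation is used with the factor [c^-1], because [c / t] is the inverse of [c^-1 * t]. In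
    the quotient the powers of [t] cancel and a power of [c] remains. *)
Lemma slowly_varying_cvg_ratio (K : R -> R) (rho : R) :
  slowly_varying (fun x => x `^ (- rho) * K x^-1) ->
  forall c, 0 < c -> K (c / t) / K t^-1 @[t --> +oo] --> c `^ (- rho).
Proof.
move=> [_ L0 Lc] c c0.
have c'0 : 0 < c^-1 by rewrite invr_gt0.
have H : c `^ (- rho) * (((c^-1 * x) `^ (- rho) * K (c^-1 * x)^-1) /
    (x `^ (- rho) * K x^-1)) @[x --> +oo] --> c `^ (- rho) * 1.
  by apply: cvgM; [exact: cvg_cst|exact: Lc].
rewrite mulr1 in H; apply: cvg_trans H; apply: near_eq_cvg; near=> x.
have x0 : 0 < x by near: x; apply: nbhs_pinfty_gt; rewrite num_real.
have xr : 0 < x `^ (- rho) by rewrite powR_gt0.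
have Kx : 0 < K x^-1 by have := L0 _ x0; rewrite pmulr_rgt0.
rewrite powRM ?ltW// invfM invrK.
have -> : c^-1 `^ (- rho) = (c `^ (- rho))^-1.
  have cr : c `^ (- rho) != 0 by rewrite gt_eqF// powR_gt0.
  apply: (mulIf cr); rewrite -powRM ?ltW// !mulVf//; first by rewrite powR1.
  by rewrite gt_eqF.
by field; rewrite !gt_eqF// powR_gt0.
Unshelve. all: by end_near. Qed.

End abelian.

(** * Asymptotics of the subordinated solution *)

(** [laplace_subordinated] with the normalising rates of the two exponential laws taken outside. For
    [p = l * K l] the factor [p / l] is [K l], and the absolute value matches [cvg_laplace0]. *)
Lemma integral_laplace_subordinated d (Omega : measurableType d) (R : realType)
    (P : probability Omega R) (S : R -> {RV P >-> R}) (G : R -> R -> R)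
    (v : R -> R) (l p : R) :
  (forall w, S 0 w = 0) ->
  (forall (s t : R) w, 0 <= s -> s <= t -> S s w <= S t w) ->
  inverse_density S G -> 0 < l -> 0 < p ->
  (forall a, 0 <= a ->
    ('E_P[fun w => expR (- (l * S a w))])%E = (expR (- (a * p)))%:E) ->
  (@lebesgue_measure R).-integrable `]0, +oo[ (EFin \o v) ->
  (forall y, 0 < y -> 0 <= v y) ->
  (\int[@lebesgue_measure R]_(s in `]0%R, +oo[)
     (\int[@lebesgue_measure R]_(tau in `]0%R, +oo[) (v tau * G s tau)%:E *
      (expR (- (l * s)))%:E) =
   (p / l * \int[@lebesgue_measure R]_(y in `]0, +oo[)
      (v y * expR (- (`|p| * y)))%R)%:E)%E.
Proof.
move=> S0 S_nd hG l0 p0 hlap iv v0.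
have mv : measurable_fun (`]0, +oo[ : set R) v.
  by apply/measurable_EFinP; exact: (measurable_int (@lebesgue_measure R)).
have mf := measurable_subordinated S_nd hG mv v0.
have me (c : R) : measurable_fun (`]0, +oo[ : set R) (fun s => expR (- (c * s))).
  by apply: measurable_funTS; exact: measurable_decay.
have f0 s : 0 < s ->
    (0 <= \int[@lebesgue_measure R]_(tau in `]0%R, +oo[) (v tau * G s tau)%:E)%E.
  move=> s0; have [_ G0 _] := hG _ s0.
  apply: integral_ge0 => y; rewrite /= in_itv/= andbT => y0.
  by rewrite lee_fin mulr_ge0 ?v0 ?G0.
have H := laplace_subordinated S0 S_nd hG l0 p0 hlap mv v0.
have mve : measurable_fun (`]0, +oo[ : set R) (fun y => v y * expR (- (p * y))).
  exact: measurable_funM.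
have ive : (@lebesgue_measure R).-integrable `]0, +oo[
    (fun y => (v y * expR (- (p * y)))%:E).
  apply: le_integrable iv => //; first by apply/measurable_EFinP; exact: mve.
  move=> y; rewrite /= in_itv/= andbT => y0; rewrite lee_fin normrM.
  rewrite (ger0_norm (expR_ge0 _)) -[leRHS]mulr1 ler_wpM2l//.
  by rewrite -expR0 ler_expR oppr_le0 mulr_ge0// ltW.
have Hl : (l%:E * \int[@lebesgue_measure R]_(s in `]0%R, +oo[)
    (\int[@lebesgue_measure R]_(tau in `]0%R, +oo[) (v tau * G s tau)%:E *
      (expR (- (l * s)))%:E) = (p * \int[@lebesgue_measure R]_(y in `]0, +oo[)
      (v y * expR (- (p * y)))%R)%:E)%E.
  rewrite EFinM fineK; last exact: integrable_fin_num.
  rewrite -!ge0_integralZl_EFin ?ltW//.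
  - under eq_integral do rewrite muleCA -EFinM.
    rewrite H; apply: eq_integral => y _.
    by rewrite -EFinM mulrCA.
  - move=> y; rewrite /= in_itv/= andbT => y0.
    by rewrite lee_fin mulr_ge0 ?expR_ge0 ?v0.
  - by apply/measurable_EFinP; exact: mve.
  - move=> s; rewrite /= in_itv/= andbT => s0.
    by rewrite mule_ge0 ?f0// lee_fin expR_ge0.
  - by apply: emeasurable_funM => //; apply/measurable_EFinP; exact: me.
rewrite gtr0_norm// mulrAC EFinM -Hl muleAC -EFinM divff ?gt_eqF// mul1e.
by [].
Qed.

Theorem theorem1p1 (R : realType) (N : nat) (hN : (1 <= N)%N)
    (A : operator R N) (hA : markov_generator A)
    (v : function R N -> N.-tuple R -> R -> R)
    (hv : forall phi : function R N,
      (lebesgue_tuple N).-integrable setT (EFin \o phi) ->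
      (forall x, 0 <= phi x) ->
      [/\ cauchy_solution A phi (v phi),
        forall (x : N.-tuple R) (t : R), 0 <= t -> 0 <= v phi x t &
        forall x, (@lebesgue_measure R).-integrable `]0, +oo[
          (EFin \o v phi x)])
    (d : measure_display) (Omega : measurableType d) (P : probability Omega R)
    (S : R -> {RV P >-> R}) (sigma : {measure set R -> \bar R})
    (hS : subordinator S sigma)
    (G : R -> R -> R) (hG : inverse_density S G)
    (k : R -> R) (hk0 : forall t : R, 0 < t -> 0 <= k t)
    (hk1 : loc_integrable k) (hk : associated_kernel sigma k)
    (hK : l * laplace_transform k l @[l --> 0^'+] --> (0 : R))
    (rho : R) (hrho : 0 <= rho)
    (hL : slowly_varying (fun x => x `^ (- rho) * laplace_transform k x^-1)) :
  forall phi : function R N,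
    (lebesgue_tuple N).-integrable setT (EFin \o phi) ->
    (forall x, 0 <= phi x) ->
    forall x : N.-tuple R,
    ((t^-1)%:E *
      (\int[@lebesgue_measure R]_(s in `]0%R, t]) subordinated (v phi) G x s) *
      ((t^-1 * laplace_transform k t^-1)^-1)%:E)%E @[t --> +oo%R] -->
    ((\int[@lebesgue_measure R]_(tau in `]0, +oo[) v phi x tau) /
      Gamma (rho + 1))%:E.
Proof.
move=> phi iphi phi0 x.
have [_ v0 iv] := hv phi iphi phi0.
have [_ S0 S_nd [_ _ hlap]] := hS.
set K := laplace_transform k.
set f := subordinated (v phi) G x.
have K0 l : 0 < l -> 0 < K l.
  move=> l0; have [_ L0 _] := hL; have l1 : 0 < l^-1 by rewrite invr_gt0.
  by have := L0 _ l1; rewrite invrK pmulr_rgt0// powR_gt0.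
have lK0 l : 0 < l -> 0 < l * K l by move=> l0; rewrite mulr_gt0 ?K0.
have Slap l (l0 : 0 < l) a : 0 <= a ->
    ('E_P[fun w => expR (- (l * S a w))])%E = (expR (- (a * (l * K l))))%:E.
  move=> a0; rewrite hlap// ?ltW// (laplace_exponentE hk l0)//.
  exact: K0.
have vx0 y : 0 < y -> 0 <= v phi x y by move=> y0; rewrite v0 ?ltW.
pose J (q : R) := \int[@lebesgue_measure R]_(y in `]0, +oo[)
  (v phi x y * expR (- (`|q| * y))).
have omega l : 0 < l ->
    (\int[@lebesgue_measure R]_(s in `]0%R, +oo[) (f s * (expR (- (l * s)))%:E) =
     (K l * J (l * K l))%:E)%E.
  move=> l0; rewrite /f /subordinated.
  rewrite (integral_laplace_subordinated S0 S_nd hG l0 (lK0 _ l0) (Slap _ l0))//.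
  rewrite (_ : l * K l / l = K l)//.
  by rewrite mulrAC divff ?gt_eqF// mul1r.
have mv : measurable_fun (`]0, +oo[ : set R) (v phi x).
  by apply/measurable_EFinP; exact: (measurable_int (@lebesgue_measure R)).
have mf : measurable_fun (`]0, +oo[ : set R) f.
  exact: (measurable_subordinated S_nd hG mv vx0).
have f0 s : 0 < s -> (0 <= f s)%E.
  move=> s0; have [_ G0 _] := hG _ s0.
  apply: integral_ge0 => y; rewrite /= in_itv/= andbT => y0.
  by rewrite lee_fin mulr_ge0 ?vx0 ?G0.
have flap l : 0 < l ->
    (\int[@lebesgue_measure R]_(s in `]0%R, +oo[)
      (f s * (expR (- (l * s)))%:E) < +oo)%E.
  by move=> l0; rewrite omega// ltry.
pose U := primitive f.
have U_laplace l (l0 : 0 < l) := laplace_primitive mf f0 flap l0.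
have mU : measurable_fun (`]0, +oo[ : set R) U.
  apply: nondecreasing_measurable => //.
  exact: primitive_nondecreasing.
have mUe l : measurable_fun (`]0, +oo[ : set R) (fun s => expR (- (l * s)) * U s).
  by apply: measurable_funM => //; apply: measurable_funTS; exact: measurable_decay.
have U0 s : 0 <= U s by exact: primitive_ge0.
have U_laplaceE l : 0 < l ->
    (l%:E * \int[@lebesgue_measure R]_(s in `]0%R, +oo[)
      (expR (- (l * s)) * U s)%:E = (K l * J (l * K l))%:E)%E.
  move=> l0; rewrite -omega// -U_laplace// -ge0_integralZl_EFin ?ltW//.
  - by apply: eq_integral => s _; rewrite -EFinM /U; congr EFin; ring.
  - by move=> s _; rewrite lee_fin mulr_ge0 ?expR_ge0.
  - by apply/measurable_EFinP; exact: mUe.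
have U_int l : 0 < l -> (@lebesgue_measure R).-integrable `]0, +oo[
    (fun s => (expR (- (l * s)) * U s)%:E).
  move=> l0; apply/integrableP; split; first by apply/measurable_EFinP; exact: mUe.
  under eq_integral do rewrite gee0_abs ?lee_fin ?mulr_ge0 ?expR_ge0//.
  (* Integrability is read off the identity: [l] times the integral is a real number, so the
     integral is not [+oo]. *)
  have := U_laplaceE _ l0; case: (integral _ _ _) => [r _||] //=.
    by rewrite ltry.
  by rewrite gt0_muley// lte_fin.
have U_K : l * (\int[@lebesgue_measure R]_(s in `]0, +oo[)
      (expR (- (l * s)) * U s)) / K l @[l --> 0^'+] --> J 0.
  (* Division by [K l] leaves [J (l * K l)], and [hK] is what sends the argument of [J] to 0. *)
  have JK : J (l * K l) @[l --> 0^'+] --> J 0.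
    apply: (cvg_comp (fun l => l * K l) J); first exact: hK.
    have := cvg_laplace0 (iv x); rewrite (_ : Rintegral _ _ _ = J 0)//.
    by apply: eq_Rintegral => y _; rewrite normr0 mul0r oppr0 expR0 mulr1.
  apply: cvg_trans JK; apply: near_eq_cvg; near=> l.
  have l0 : 0 < l by near: l; exact: nbhs_right_gt.
  rewrite /Rintegral -[l in RHS]/(fine l%:E) -fineM//; last first.
    exact: integrable_fin_num (U_int _ l0).
  by rewrite U_laplaceE//= mulrAC divff ?mul1r// gt_eqF// K0.
have U_nd s t : 0 < s -> s <= t -> U s <= U t.
  by move=> _ st; exact: primitive_nondecreasing.
have := karamata_tauberian hrho (fun s _ => U0 s) U_nd U_int K0
  (slowly_varying_cvg_ratio hL) U_K.
have -> : J 0 = \int[@lebesgue_measure R]_(tau in `]0, +oo[) v phi x tau.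
  by apply: eq_Rintegral => y _; rewrite normr0 mul0r oppr0 expR0 mulr1.
set g := _ / _ => lim.
have lim' : (U t / K t^-1)%:E @[t --> +oo] --> g%:E.
  by apply: cvg_EFin; [exact: nearW|exact: lim].
(* The [t^-1] of the time average cancels against that of the denominator, leaving
   [U t / K t^-1]. *)
apply: cvg_trans lim'; apply: near_eq_cvg; near=> t.
have t0 : 0 < t by near: t; apply: nbhs_pinfty_gt; rewrite num_real.
rewrite -EFin_primitive//= -!EFinM; congr EFin; rewrite -/U -/K.
have Kt : 0 < K t^-1 by rewrite K0 ?invr_gt0.
by field; rewrite !gt_eqF.
Unshelve. all: by end_near. Qed.
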